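(* Let $R$ be an associative ring with identity, with data $I_\ell, J_\ell, X_\ell, S_\ell, Y_\ell, D_\ell, T_\ell$ ($1\le \ell\le t$), $T$, $Z=Z(T)$ and $\eta\colon R\to T$ as described in the context. Assume: (A) $T_\ell$ is right noetherian for all $\ell$; (B) $Y_\ell=\{Q\in\operatorname{Spec}S_\ell \mid D_\ell\subseteq \mathcal{C}_{S_\ell}(Q)\}$ for all $\ell$; (C) $T_\ell$ is ideally commutative for all $\ell$. For $\mathfrak{q}\in\operatorname{Spec}Z$ set $$\theta(\mathfrak{q})=\operatorname{ann}(T/\mathfrak{q}T)_R=\operatorname{ann}\big((Z/\mathfrak{q})\otimes_Z T\big)_R,$$ which is a prime ideal of $R$. Then: (i) The function $\theta\colon\operatorname{Spec}Z\to\operatorname{Spec}R$ is continuous, finite-to-one (all fibers are finite), and surjective. If $X_1,\ldots,X_t$ are pairwise disjoint then $\theta$ is bijective. (ii) For all $\mathfrak{q}\in\operatorname{Spec}Z$, $\theta(\mathfrak{q})$ is locally closed if and only if $\mathfrak{q}$ is locally closed. (iii) Assume in addition that (D) $R$ is an algebra over a field $\Bbbk$ satisfying the Nullstellensatz over $\Bbbk$. Then for all $\mathfrak{q}\in\operatorname{Spec}Z$, $\theta(\mathfrak{q})$ is primitive if and only if $\mathfrak{q}$ is maximal. Consequently, $\theta$ restricts to a map $\operatorname{Max}Z\to\operatorname{Prim}R$ which is continuous, finite-to-one, and surjective.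
   Context: Conventions. For a ring $\Lambda$: $Z(\Lambda)$ is its center; $\mathcal{C}_\Lambda(I)$ is the set of elements of $\Lambda$ that are regular modulo the ideal $I$; $\operatorname{Spec}\Lambda$, $\operatorname{Prim}\Lambda$, $\operatorname{Max}\Lambda$ are the sets of prime, right primitive, and maximal ideals, each with the Zariski/Jacobson topology, whose closed sets are the sets $V(E)$ of all such ideals containing a subset $E\subseteq\Lambda$. ''Primitive'' means right primitive. A prime ideal $P$ of $\Lambda$ is locally closed if it is a locally closed point of $\operatorname{Spec}\Lambda$, i.e. $P\subsetneq\bigcap\{Q'\in\operatorname{Spec}\Lambda\mid Q'\supsetneq P\}$ (the empty intersection being $\Lambda$). A right denominator set of $\Lambda$ is a multiplicatively closed right Ore set $D$ for which the canonical right Ore localization map $\Lambda\to\Lambda D^{-1}$ is injective (equivalently, a right Ore set of regular elements). $\Lambda$ is ideally commutative if $\mathfrak{a}\mapsto\mathfrak{a}\cap Z(\Lambda)$ and $\mathfrak{b}\mapsto\mathfrak{b}\Lambda$ are mutually inverse, product preserving bijections between the set of ideals $\mathfrak{a}$ of $\Lambda$ and the set of ideals $\mathfrak{b}$ of $Z(\Lambda)$. Setup. $I_1,J_1,\ldots,I_t,J_t$ are ideals of $R$ such that $\operatorname{Spec}R=X_1\cup\cdots\cup X_t$, where $X_\ell=V(I_\ell)\setminus V(J_\ell)$ (not necessarily disjoint). Put $S_\ell=R/I_\ell$, and $Y_\ell=\operatorname{Spec}S_\ell\setminus V_{S_\ell}((J_\ell+I_\ell)/I_\ell)$. Let $D_\ell$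 be a right denominator set of $S_\ell$, let $T_\ell=S_\ell D_\ell^{-1}$, and let $T=T_1\times\cdots\times T_t$, with center $Z=Z(T_1)\times\cdots\times Z(T_t)$. The ring homomorphism $\eta\colon R\to T$ is the composite of $R\to S_1\times\cdots\times S_t$, $r\mapsto(r+I_1,\ldots,r+I_t)$, with the product of the localization maps $S_\ell\to T_\ell$; right $T$-modules are viewed as right $R$-modules via $\eta$, and $\operatorname{ann}(M)_R$ is the annihilator in $R$ of the right $R$-module $M$. A $\Bbbk$-algebra $\Lambda$ satisfies the Nullstellensatz over $\Bbbk$ if $\operatorname{End}(M_\Lambda)$ is algebraic over $\Bbbk$ for every simple right $\Lambda$-module $M$, and the Jacobson radical of every factor ring of $\Lambda$ is nil. *)

(* Defs.v *)
From HB Require Import structures.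
From mathcomp Require Import all_boot all_order all_algebra.
From mathcomp Require Import all_classical topology.

Set Implicit Arguments.
Unset Strict Implicit.
Unset Printing Implicit Defensive.

Import GRing.Theory.

Local Open Scope classical_set_scope.
Local Open Scope ring_scope.
Local Open Scope quotient_scope.

(* Rings are [pzRingType]s: associative, unital, possibly zero.  A right module
   over [R] is a left module over the converse ring [R^c], so that [r *: m]
   with [r : R^c] stands for the right action [m r]. *)
Notation rmodType R := (lmodType R^c).

Record submodule (K : pzRingType) (M : lmodType K) := Submodule {
  submodule_set :> set M;
  submodule0 : submodule_set 0;
  submoduleD : forall x y,
    submodule_set x -> submodule_set y -> submodule_set (x + y);
  submoduleZ : forall (a : K) x, submodule_set x -> submodule_set (a *: x) }.

Section QuotientModule.
Variables (K : pzRingType) (M : lmodType K) (N : submodule M).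

Definition submodule_pred : {pred M} := fun x => `[< submodule_set N x >].

Lemma submodule_pred_zmod : zmod_closed submodule_pred.
Proof.
split; first by apply/asboolP; exact: submodule0.
move=> x y /asboolP Nx /asboolP Ny; apply/asboolP; apply: submoduleD => //.
by rewrite -scaleN1r; exact: submoduleZ.
Qed.

HB.instance Definition _ :=
  GRing.isZmodClosed.Build M submodule_pred submodule_pred_zmod.

Definition quotient_module : Type := Quotient.quot submodule_pred.
HB.instance Definition _ := GRing.Zmodule.on quotient_module.

Definition module_proj (x : M) : quotient_module :=
  \pi_(Quotient.quot submodule_pred) x.

Lemma module_projE x y : module_proj x = module_proj y <-> submodule_set N (x - y).
Proof.
rewrite /module_proj; split=> [/eqP|Nxy].
  by rewrite -Quotient.idealrBE => /asboolP.
by apply/eqP; rewrite -Quotient.idealrBE; apply/asboolP.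
Qed.

Definition module_repr (u : quotient_module) : M :=
  repr (u : Quotient.quot submodule_pred).

Lemma module_reprK : cancel module_repr module_proj.
Proof. exact: reprK. Qed.

Lemma module_projP (u : quotient_module) : exists x, u = module_proj x.
Proof. by exists (module_repr u); rewrite module_reprK. Qed.

Lemma module_projD x y : module_proj (x + y) = module_proj x + module_proj y.
Proof. exact: (raddfD (\pi_(Quotient.quot submodule_pred))). Qed.

Definition quotient_scale (a : K) (u : quotient_module) : quotient_module :=
  module_proj (a *: module_repr u).

Lemma quotient_scaleE a x :
  quotient_scale a (module_proj x) = module_proj (a *: x).
Proof.
apply/module_projE; rewrite -scalerBr; apply: submoduleZ.
by apply/module_projE; rewrite module_reprK.
Qed.

Lemma quotient_scaleA a b u :
  quotient_scale a (quotient_scale b u) = quotient_scale (a * b) u.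
Proof.
by have [x ->] := module_projP u; rewrite !quotient_scaleE scalerA.
Qed.

Lemma quotient_scale1 : left_id 1 quotient_scale.
Proof.
by move=> u; have [x ->] := module_projP u; rewrite quotient_scaleE scale1r.
Qed.

Lemma quotient_scaleDr : right_distributive quotient_scale +%R.
Proof.
move=> a u v; have [x ->] := module_projP u; have [y ->] := module_projP v.
by rewrite -module_projD !quotient_scaleE scalerDr module_projD.
Qed.

Lemma quotient_scaleDl u : {morph quotient_scale^~ u : a b / a + b}.
Proof.
move=> a b; have [x ->] := module_projP u.
by rewrite !quotient_scaleE scalerDl module_projD.
Qed.

HB.instance Definition _ := GRing.Zmodule_isLmodule.Build K quotient_module
  quotient_scaleA quotient_scale1 quotient_scaleDr quotient_scaleDl.

End QuotientModule.

(* The [K']-module [M] viewed as a [K]-module along [f : K -> K']. *)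
Definition restrict_scalars (K K' : pzRingType) (f : {rmorphism K -> K'})
  (M : lmodType K') : Type := M.

Section RestrictScalars.
Variables (K K' : pzRingType) (f : {rmorphism K -> K'}) (M : lmodType K').

HB.instance Definition _ := GRing.Zmodule.copy (restrict_scalars f M) M.

Let scale (a : K) (x : restrict_scalars f M) : restrict_scalars f M :=
  f a *: (x : M).

Lemma restrict_scaleA a b x : scale a (scale b x) = scale (a * b) x.
Proof. by rewrite /scale scalerA rmorphM. Qed.

Lemma restrict_scale1 : left_id 1 scale.
Proof. by move=> x; rewrite /scale rmorph1 scale1r. Qed.

Lemma restrict_scaleDr : right_distributive scale +%R.
Proof. by move=> a x y; exact: scalerDr. Qed.

Lemma restrict_scaleDl x : {morph scale^~ x : a b / a + b}.
Proof. by move=> a b; rewrite /scale rmorphD scalerDl. Qed.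

HB.instance Definition _ := GRing.Zmodule_isLmodule.Build K
  (restrict_scalars f M)
  restrict_scaleA restrict_scale1 restrict_scaleDr restrict_scaleDl.

End RestrictScalars.

Definition converse_morphism (R S : pzRingType) (f : R -> S) : R^c -> S^c := f.

Section ConverseMorphism.
Variables (R S : pzRingType) (f : {rmorphism R -> S}).

Lemma converse_morphism_zmod : zmod_morphism (converse_morphism f).
Proof. by move=> x y; exact: (rmorphB f x y). Qed.

Lemma converse_morphism_monoid : monoid_morphism (converse_morphism f).
Proof. by split=> [|x y]; [exact: (rmorph1 f) | exact: (rmorphM f y x)]. Qed.

HB.instance Definition _ := GRing.isZmodMorphism.Build R^c S^c
  (converse_morphism f) converse_morphism_zmod.
HB.instance Definition _ := GRing.isMonoidMorphism.Build R^c S^c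
  (converse_morphism f) converse_morphism_monoid.

Definition converse_rmorphism : {rmorphism R^c -> S^c} := converse_morphism f.

End ConverseMorphism.

Definition simple_module (K : pzRingType) (M : lmodType K) :=
  (exists x : M, x <> 0) /\
  forall N : submodule M, N = [set 0] :> set M \/ N = [set: M] :> set M.

Definition noetherian_module (K : pzRingType) (M : lmodType K) :=
  forall N : nat -> submodule M, (forall n, N n `<=` N n.+1) ->
  exists n, forall m, (n <= m)%N -> N m = N n :> set M.

Definition right_noetherian (R : pzRingType) := noetherian_module (R^c)^o.

Definition annihilator (R : pzRingType) (M : rmodType R) : set R :=
  [set r | forall m : M, (r : R^c) *: m = 0].

Definition balanced (Z : comPzRingType) (X Y : lmodType Z) (W : zmodType)
    (f : X -> Y -> W) :=
  [/\ forall x y1 y2, f x (y1 + y2) = f x y1 + f x y2,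
      forall x1 x2 y, f (x1 + x2) y = f x1 y + f x2 y
    & forall z x y, f (z *: x) y = f x (z *: y)].

(* The abelian group [W], with [tau x y] standing for x (x) y, is a tensor
   product of [X] and [Y] over [Z]. *)
Definition is_tensor_product (Z : comPzRingType) (X Y : lmodType Z)
    (W : zmodType) (tau : X -> Y -> W) :=
  [/\ balanced tau,
      forall (W' : zmodType) (f : X -> Y -> W'), balanced f ->
        exists h : {additive W -> W'}, forall x y, h (tau x y) = f x y
    & forall (W' : zmodType) (h1 h2 : {additive W -> W'}),
        (forall x y, h1 (tau x y) = h2 (tau x y)) -> h1 =1 h2].

Record ideal (R : pzRingType) := Ideal {
  ideal_set :> set R;
  ideal0 : ideal_set 0;
  idealD : forall x y, ideal_set x -> ideal_set y -> ideal_set (x + y);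
  idealMl : forall r x, ideal_set x -> ideal_set (r * x);
  idealMr : forall r x, ideal_set x -> ideal_set (x * r) }.

Lemma ideal_eq (R : pzRingType) (A B : ideal R) : A = B :> set R -> A = B.
Proof.
case: A B => [A a0 aD aL aR] [B b0 bD bL bR] /= eAB; subst B.
by congr Ideal; exact: Prop_irrelevance.
Qed.

(* [ideal_submodule f A] is the ideal [A] of [T], seen inside the right module
   T_R obtained from [f : R -> T]. *)
Section IdealSubmodule.
Variables (R T : pzRingType) (f : {rmorphism R -> T}) (A : ideal T).

Definition right_restriction : Type :=
  restrict_scalars (converse_rmorphism f) (T^c)^o.
HB.instance Definition _ := GRing.Lmodule.on right_restriction.

Definition ideal_submodule : submodule right_restriction :=
  @Submodule R^c right_restriction (ideal_set A) (@ideal0 _ A) (@idealD _ A)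
    (fun r x => @idealMr _ A (f r) x).

End IdealSubmodule.

Definition ideal_left_submodule (R : pzRingType) (A : ideal R) :
  submodule R^o := @Submodule R R^o (ideal_set A) (@ideal0 _ A) (@idealD _ A) (@idealMl _ A).

Section QuotientRing.
Variables (R : pzRingType) (A : ideal R).

Definition quotient_ring : Type := quotient_module (ideal_left_submodule A).
HB.instance Definition _ := GRing.Zmodule.on quotient_ring.

Definition ring_proj (x : R) : quotient_ring :=
  module_proj (ideal_left_submodule A) x.

Lemma ring_projE x y : ring_proj x = ring_proj y <-> ideal_set A (x - y).
Proof. exact: module_projE. Qed.

Lemma ring_projP (u : quotient_ring) : exists x, u = ring_proj x.
Proof. exact: (@module_projP _ _ (ideal_left_submodule A) u). Qed.

Definition ring_repr (u : quotient_ring) : R := module_repr u.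

Lemma ring_reprK : cancel ring_repr ring_proj.
Proof. exact: module_reprK. Qed.

Definition quotient_mul (u v : quotient_ring) : quotient_ring :=
  ring_proj (ring_repr u * ring_repr v).

Lemma quotient_mulE x y :
  quotient_mul (ring_proj x) (ring_proj y) = ring_proj (x * y).
Proof.
rewrite /quotient_mul.
have /ring_projE := ring_reprK (ring_proj x).
have /ring_projE := ring_reprK (ring_proj y).
move: (ring_repr _) (ring_repr _) => x' y' Ay Ax; apply/ring_projE.
rewrite -(subrKA (x' * y)) -mulrBr -mulrBl.
by apply: idealD; [exact: idealMl | exact: idealMr].
Qed.

Lemma ring_proj_zmod : zmod_morphism ring_proj.
Proof. exact: (raddfB (\pi_(Quotient.quot (submodule_pred (ideal_left_submodule A))))). Qed.

HB.instance Definition _ := GRing.isZmodMorphism.Build R quotient_ring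
  ring_proj ring_proj_zmod.

Lemma quotient_mulA : associative quotient_mul.
Proof.
move=> u v w; have [x ->] := ring_projP u; have [y ->] := ring_projP v.
by have [z ->] := ring_projP w; rewrite !quotient_mulE mulrA.
Qed.

Lemma quotient_mul1l : left_id (ring_proj 1) quotient_mul.
Proof.
by move=> u; have [x ->] := ring_projP u; rewrite quotient_mulE mul1r.
Qed.

Lemma quotient_mul1r : right_id (ring_proj 1) quotient_mul.
Proof.
by move=> u; have [x ->] := ring_projP u; rewrite quotient_mulE mulr1.
Qed.

Lemma quotient_mulDl : left_distributive quotient_mul +%R.
Proof.
move=> u v w; have [x ->] := ring_projP u; have [y ->] := ring_projP v.
have [z ->] := ring_projP w.
by rewrite -raddfD !quotient_mulE mulrDl raddfD.
Qed.

Lemma quotient_mulDr : right_distributive quotient_mul +%R.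
Proof.
move=> u v w; have [x ->] := ring_projP u; have [y ->] := ring_projP v.
have [z ->] := ring_projP w.
by rewrite -raddfD !quotient_mulE mulrDr raddfD.
Qed.

HB.instance Definition _ := GRing.Zmodule_isPzRing.Build quotient_ring
  quotient_mulA quotient_mul1l quotient_mul1r quotient_mulDl quotient_mulDr.

Lemma ring_proj_monoid : monoid_morphism ring_proj.
Proof. by split=> // x y; rewrite -quotient_mulE. Qed.

HB.instance Definition _ := GRing.isMonoidMorphism.Build R quotient_ring
  ring_proj ring_proj_monoid.

End QuotientRing.

Definition sum_of_products (R : pzRingType) (A B : set R) : set R :=
  [set x | exists2 s : seq (R * R),
     (forall p, p \in s -> A p.1 /\ B p.2) & x = \sum_(p <- s) p.1 * p.2].

Section SumOfProducts.
Variables (R : pzRingType) (A B : set R).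

Lemma sum_of_products0 : sum_of_products A B 0.
Proof. by exists [::]; rewrite ?big_nil. Qed.

Lemma sum_of_productsD x y : sum_of_products A B x ->
  sum_of_products A B y -> sum_of_products A B (x + y).
Proof.
move=> [s sAB ->] [s' s'AB ->]; exists (s ++ s'); last by rewrite big_cat.
by move=> p; rewrite mem_cat => /orP[/sAB|/s'AB].
Qed.

Lemma sum_of_productsMl r x : (forall a, A a -> A (r * a)) ->
  sum_of_products A B x -> sum_of_products A B (r * x).
Proof.
move=> rA [s sAB ->]; exists [seq (r * p.1, p.2) | p <- s].
  by move=> _ /mapP[p /sAB[Ap Bp] ->]; split=> //=; exact: rA.
by rewrite big_map mulr_sumr; apply: eq_bigr => p _; rewrite mulrA.
Qed.

Lemma sum_of_productsMr r x : (forall b, B b -> B (b * r)) ->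
  sum_of_products A B x -> sum_of_products A B (x * r).
Proof.
move=> rB [s sAB ->]; exists [seq (p.1, p.2 * r) | p <- s].
  by move=> _ /mapP[p /sAB[Ap Bp] ->]; split=> //=; exact: rB.
by rewrite big_map mulr_suml; apply: eq_bigr => p _; rewrite mulrA.
Qed.

End SumOfProducts.

Definition ideal_mul (R : pzRingType) (A B : ideal R) : ideal R :=
  @Ideal R (sum_of_products A B) (@sum_of_products0 R A B)
    (@sum_of_productsD R A B)
    (fun r x => sum_of_productsMl (fun a => @idealMl R A r a))
    (fun r x => sum_of_productsMr (fun b => @idealMr R B r b)).

Definition prime_ideal (R : pzRingType) : set (ideal R) :=
  [set P | P <> [set: R] :> set R /\
     forall A B : ideal R, ideal_mul A B `<=` P -> A `<=` P \/ B `<=` P].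

Definition right_primitive (R : pzRingType) : set (ideal R) :=
  [set P | exists2 M : rmodType R, simple_module M & P = annihilator M :> set R].

Definition maximal_ideal (R : pzRingType) : set (ideal R) :=
  [set P | P <> [set: R] :> set R /\
     forall A : ideal R, P `<=` A -> A = P :> set R \/ A = [set: R] :> set R].

Definition regular_modulo (R : pzRingType) (A : ideal R) : set R :=
  [set c | GRing.lreg (ring_proj A c) /\ GRing.rreg (ring_proj A c)].

Section Center.
Variable R : pzRingType.

Definition central : {pred R} := fun z => `[< forall x : R, z * x = x * z >].

Lemma central_subring : subring_closed central.
Proof.
split=> [|x y /asboolP cx /asboolP cy|x y /asboolP cx /asboolP cy];
  apply/asboolP => z; first by rewrite mul1r mulr1.
- by rewrite mulrBl mulrBr cx cy.
- by rewrite -mulrA cy mulrA cx mulrA.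
Qed.

HB.instance Definition _ :=
  GRing.isSubringClosed.Build R central central_subring.

Record center := Center { center_val : R; center_valP : center_val \in central }.

HB.instance Definition _ := [isSub for center_val].
HB.instance Definition _ := [Choice of center by <:].
HB.instance Definition _ :=
  GRing.SubChoice_isSubPzRing.Build R central center central_subring.

Lemma center_val_zmod : zmod_morphism center_val.
Proof. exact: (rmorphB (val : center -> R)). Qed.

Lemma center_val_monoid : monoid_morphism center_val.
Proof. by split; [exact: (rmorph1 (val : center -> R)) | exact: (rmorphM (val : center -> R))]. Qed.

HB.instance Definition _ :=
  GRing.isZmodMorphism.Build center R center_val center_val_zmod.
HB.instance Definition _ :=
  GRing.isMonoidMorphism.Build center R center_val center_val_monoid.

Lemma center_mulC : commutative (@GRing.mul center).
Proof.
move=> x y; apply: val_inj.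
apply: (etrans (rmorphM center_val x y)).
apply: (etrans _ (esym (rmorphM center_val y x))).
by have /asboolP := center_valP x; exact.
Qed.

HB.instance Definition _ :=
  GRing.PzRing_hasCommutativeMul.Build center center_mulC.

End Center.

Section ContractExtend.
Variable R : pzRingType.

Definition contract (A : ideal R) : ideal (center R).
Proof.
apply: (@Ideal (center R) (@center_val R @^-1` A)) => /=.
- exact: ideal0.
- by move=> x y; exact: idealD.
- by move=> r x; exact: idealMl.
- by move=> r x; exact: idealMr.
Defined.

Definition extend (B : ideal (center R)) : ideal R.
Proof.
apply: (@Ideal R (sum_of_products (@center_val R @` B) [set: R])).
- exact: sum_of_products0.
- exact: sum_of_productsD.
- move=> r _ [s sB ->]; exists [seq (p.1, r * p.2) | p <- s].
    by move=> _ /mapP[p /sB[Bp _] ->].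
  rewrite big_map big_seq mulr_sumr [RHS]big_seq; apply: eq_bigr => p /sB[].
  by case=> z _ <- _ /=; have /asboolP cz := center_valP z; rewrite !mulrA cz.
- by move=> r x; exact: sum_of_productsMr.
Defined.

Definition ideally_commutative :=
  [/\ cancel contract extend, cancel extend contract,
      {morph contract : A B / ideal_mul A B}
    & {morph extend : A B / ideal_mul A B}].

End ContractExtend.

Record ideal_point (R : pzRingType) (C : set (ideal R)) :=
  IdealPoint { point_ideal :> ideal R; point_idealP : C point_ideal }.

HB.instance Definition _ R C := gen_eqMixin (@ideal_point R C).
HB.instance Definition _ R C := gen_choiceMixin (@ideal_point R C).

Definition Spec (R : pzRingType) : Type := ideal_point (@prime_ideal R).
Definition Prim (R : pzRingType) : Type := ideal_point (@right_primitive R).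
Definition Max (R : pzRingType) : Type := ideal_point (@maximal_ideal R).

Definition zariski_V (R : pzRingType) (C : set (ideal R)) (E : set R) :
  set (ideal_point C) := [set P : ideal_point C | E `<=` P].
Arguments zariski_V {R} C E.

Definition zariski_open (R : pzRingType) (C : set (ideal R)) :
  set_system (ideal_point C) := [set U | exists E, U = ~` zariski_V C E].
Arguments zariski_open {R} C.

Section GeneratedIdeal.
Variables (R : pzRingType) (E : set R).

Definition generated_set : set R :=
  \bigcap_(A in [set A : ideal R | E `<=` A]) A.

Definition generated_ideal : ideal R.
Proof.
apply: (@Ideal R generated_set).
- by move=> A _; exact: ideal0.
- by move=> x y Ex Ey A EA; apply: idealD; [exact: Ex | exact: Ey].
- by move=> r x Ex A EA; apply: idealMl; exact: Ex.
- by move=> r x Ex A EA; apply: idealMr; exact: Ex.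
Defined.

Lemma generated_ideal_sub (A : ideal R) : generated_ideal `<=` A <-> E `<=` A.
Proof.
split=> [gA x Ex|EA x]; last exact.
by apply: gA => B; exact.
Qed.

End GeneratedIdeal.

Section ZariskiTopology.
Variables (R : pzRingType) (C : set (ideal R)).
Hypothesis C_prime : C `<=` @prime_ideal R.

Lemma zariski_openT : zariski_open C setT.
Proof.
exists setT; rewrite -setC0; congr setC; apply/seteqP.
split=> // P /= PT; have [nP _] := C_prime (point_idealP P).
by apply: nP; apply/seteqP; split.
Qed.

Lemma zariski_openI : setI_closed (zariski_open C).
Proof.
move=> _ _ [E ->] [F ->].
exists (ideal_mul (generated_ideal E) (generated_ideal F)).
rewrite -setCU; congr setC; apply/seteqP; split=> P /=.
  move=> [] /generated_ideal_sub sP x [s sEF ->]; rewrite big_seq.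
    by apply: big_ind => [|y z|p /sEF[Ep _]];
      [exact: ideal0 | exact: idealD | exact/idealMr/sP].
  by apply: big_ind => [|y z|p /sEF[_ Fp]];
    [exact: ideal0 | exact: idealD | exact/idealMl/sP].
have [_ pP] := C_prime (point_idealP P).
move=> PEF; have [/generated_ideal_sub ?|/generated_ideal_sub ?] := pP (generated_ideal E) (generated_ideal F) PEF;
  by [left | right].
Qed.

Lemma zariski_open_bigU (I : Type) (f : I -> set (ideal_point C)) :
  (forall i, zariski_open C (f i)) -> zariski_open C (\bigcup_i f i).
Proof.
move=> fo; have [E fE] := choice fo; exists (\bigcup_i E i).
rewrite -[LHS]setCK setC_bigcup; congr setC.
apply/seteqP; split=> P /=.
  move=> fP x [i _ Ex]; have := fP i Logic.I; rewrite fE setCK; exact.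
by move=> EP i _; rewrite fE setCK => x Ex; apply: EP; exists i.
Qed.

Lemma zariski_open_nbhs :
  [set A | A `<=` (nbhs_of_open (zariski_open C))^~ A] = zariski_open C.
Proof.
apply/seteqP; split=> [A /= nA|A Ao P AP]; last by exists A; split.
suff -> : A = \bigcup_(U : {U | zariski_open C U /\ U `<=` A}) sval U.
  by apply: zariski_open_bigU => -[U []].
apply/seteqP; split=> [P /nA [U [Uo UP UA]]|P [[U [_ UA]] _ /UA //]].
by exists (exist _ U (conj Uo UA)).
Qed.

End ZariskiTopology.

Section IdealSum.
Variables (R : pzRingType) (A B : ideal R).

Definition ideal_sum : ideal R.
Proof.
apply: (@Ideal R [set a + b | a in A & b in B]).
- by exists 0; [exact: ideal0|exists 0; [exact: ideal0|rewrite addr0]].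
- move=> _ _ [a Aa [b Bb <-]] [a' Aa' [b' Bb' <-]].
  exists (a + a'); first exact: idealD.
  by exists (b + b'); [exact: idealD|rewrite addrACA].
- move=> r _ [a Aa [b Bb <-]]; exists (r * a); first exact: idealMl.
  by exists (r * b); [exact: idealMl|rewrite mulrDr].
- move=> r _ [a Aa [b Bb <-]]; exists (a * r); first exact: idealMr.
  by exists (b * r); [exact: idealMr|rewrite mulrDl].
Defined.

End IdealSum.

Lemma maximal_prime (R : pzRingType) : @maximal_ideal R `<=` @prime_ideal R.
Proof.
move=> P [nP maxP]; split=> // A B sAB.
have PA : P `<=` ideal_sum P A.
  by move=> x Px; exists x => //; exists 0; [exact: ideal0|rewrite addr0].
case: (maxP _ PA) => eP; [left|right].
  move=> a Aa; rewrite -eP; exists 0; first exact: ideal0.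
  by exists a => //; rewrite add0r.
have [p Pp [a Aa pa1]] : ideal_set (ideal_sum P A) 1 by rewrite eP.
move=> b Bb; rewrite -(mul1r b) -pa1 mulrDl; apply: idealD; first exact: idealMr.
apply: sAB; exists [:: (a, b)]; last by rewrite big_seq1.
by move=> _ /[1!inE] /eqP ->.
Qed.

Lemma primitive_prime (R : pzRingType) :
  @right_primitive R `<=` @prime_ideal R.
Proof.
move=> P [M [[x x0] simM] eP]; split=> [P1|A B sAB].
  have : annihilator M 1 by rewrite -eP P1.
  by move=> /(_ x); rewrite (scale1r (x : M)).
pose K := [set m : M | forall b : R, ideal_set B b -> (b : R^c) *: m = 0].
have K0 : K 0 by move=> b _; rewrite scaler0.
have KD x1 x2 : K x1 -> K x2 -> K (x1 + x2).
  by move=> K1 K2 b Bb; rewrite scalerDr K1 // K2 // addr0.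
have KZ (r : R^c) m : K m -> K (r *: m).
  move=> Km b Bb; rewrite scalerA; apply: Km.
  by exact: (@idealMl _ B (r : R) b).
case: (simM (Submodule K0 KD KZ)) => /= eK; [left => a Aa|right => b Bb].
  rewrite eP => m; suff : K ((a : R^c) *: m) by rewrite eK.
  move=> b Bb; rewrite scalerA.
  have : annihilator M (a * b) => [|/(_ m) //].
  rewrite -eP; apply: sAB; exists [:: (a, b)]; last by rewrite big_seq1.
  by move=> _ /[1!inE] /eqP ->.
rewrite eP => m; have Km : K m by rewrite eK.
exact: Km.
Qed.

HB.instance Definition _ (R : pzRingType) := Choice.on (Spec R).
HB.instance Definition _ (R : pzRingType) := isOpenTopological.Build (Spec R)
  (zariski_openT (@subset_refl _ _)) (zariski_openI (@subset_refl _ _))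
  (@zariski_open_bigU R (@prime_ideal R)).
HB.instance Definition _ (R : pzRingType) := Choice.on (Prim R).
HB.instance Definition _ (R : pzRingType) := isOpenTopological.Build (Prim R)
  (zariski_openT (@primitive_prime R)) (zariski_openI (@primitive_prime R))
  (@zariski_open_bigU R (@right_primitive R)).
HB.instance Definition _ (R : pzRingType) := Choice.on (Max R).
HB.instance Definition _ (R : pzRingType) := isOpenTopological.Build (Max R)
  (zariski_openT (@maximal_prime R)) (zariski_openI (@maximal_prime R))
  (@zariski_open_bigU R (@maximal_ideal R)).

Lemma Spec_openE (R : pzRingType) :
  @open (Spec R) = zariski_open (@prime_ideal R).
Proof. by rewrite openE; exact: zariski_open_nbhs. Qed.

Lemma Prim_openE (R : pzRingType) :
  @open (Prim R) = zariski_open (@right_primitive R).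
Proof. by rewrite openE; exact: zariski_open_nbhs. Qed.

Lemma Max_openE (R : pzRingType) :
  @open (Max R) = zariski_open (@maximal_ideal R).
Proof. by rewrite openE; exact: zariski_open_nbhs. Qed.

Definition Max_Spec (R : pzRingType) (P : Max R) : Spec R :=
  IdealPoint (maximal_prime (point_idealP P)).

Definition locally_closed (R : pzRingType) (P : Spec R) :=
  (P : set R) `<` \bigcap_(Q in [set Q : Spec R | (P : set R) `<` Q]) Q.

Definition right_ore_set (S : pzRingType) (D : set S) :=
  [/\ D 1, forall c d, D c -> D d -> D (c * d)
    & forall s d, D d -> exists s' d', D d' /\ s * d' = d * s'].

(* A right Ore set of regular elements, i.e. one whose right Ore localization
   map is injective. *)
Definition right_denominator_set (S : pzRingType) (D : set S) :=
  right_ore_set D /\ forall d, D d -> GRing.lreg d /\ GRing.rreg d.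

(* [lambda : S -> T] exhibits [T] as S D^-1, which is thereby determined up to a
   unique isomorphism over [S]: the elements of [D] become units, every element
   of [T] has the form lambda(s) lambda(d)^-1, and the kernel consists of the
   elements killed on the right by an element of [D]. *)
Definition right_ore_localization (S T : pzRingType) (D : set S)
    (lambda : {rmorphism S -> T}) :=
  [/\ forall d, D d -> exists u, lambda d * u = 1 /\ u * lambda d = 1,
      forall x, exists s d, D d /\ x * lambda d = lambda s
    & forall s, lambda s = 0 <-> exists2 d, D d & s * d = 0].

Definition product_ring (t : nat) (T : 'I_t -> pzRingType) : Type :=
  forall l, T l.

Section ProductRing.
Variables (t : nat) (T : 'I_t -> pzRingType).
Implicit Types x y z : product_ring T.

HB.instance Definition _ := gen_eqMixin (product_ring T).
HB.instance Definition _ := gen_choiceMixin (product_ring T).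

Definition product_add x y : product_ring T := fun l => x l + y l.
Definition product_mul x y : product_ring T := fun l => x l * y l.
Definition product_opp x : product_ring T := fun l => - x l.
Definition product_zero : product_ring T := fun=> 0.
Definition product_one : product_ring T := fun=> 1.

Lemma product_addA : associative product_add.
Proof. by move=> x y z; apply: functional_extensionality_dep => l; exact: addrA. Qed.

Lemma product_addC : commutative product_add.
Proof. by move=> x y; apply: functional_extensionality_dep => l; exact: addrC. Qed.

Lemma product_add0 : left_id product_zero product_add.
Proof. by move=> x; apply: functional_extensionality_dep => l; exact: add0r. Qed.

Lemma product_addN : left_inverse product_zero product_opp product_add.
Proof. by move=> x; apply: functional_extensionality_dep => l; exact: addNr. Qed.

HB.instance Definition _ := GRing.isZmodule.Build (product_ring T)
  product_addA product_addC product_add0 product_addN.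

Lemma product_mulA : associative product_mul.
Proof. by move=> x y z; apply: functional_extensionality_dep => l; exact: mulrA. Qed.

Lemma product_mul1l : left_id product_one product_mul.
Proof. by move=> x; apply: functional_extensionality_dep => l; exact: mul1r. Qed.

Lemma product_mul1r : right_id product_one product_mul.
Proof. by move=> x; apply: functional_extensionality_dep => l; exact: mulr1. Qed.

Lemma product_mulDl : left_distributive product_mul +%R.
Proof. by move=> x y z; apply: functional_extensionality_dep => l; exact: mulrDl. Qed.

Lemma product_mulDr : right_distributive product_mul +%R.
Proof. by move=> x y z; apply: functional_extensionality_dep => l; exact: mulrDr. Qed.

HB.instance Definition _ := GRing.Zmodule_isPzRing.Build (product_ring T)
  product_mulA product_mul1l product_mul1r product_mulDl product_mulDr.

End ProductRing.

Section Setup.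
Variables (R : pzRingType) (t : nat) (I J : 'I_t -> ideal R).

Definition stratum (l : 'I_t) : set (Spec R) :=
  zariski_V (@prime_ideal R) (I l) `\` zariski_V (@prime_ideal R) (J l).

(* Y_l, a subset of the spectrum of S_l = R / I_l. *)
Definition factor_stratum (l : 'I_t) : set (Spec (quotient_ring (I l))) :=
  ~` zariski_V (@prime_ideal (quotient_ring (I l)))
       (@ring_proj R (I l) @` ideal_sum (J l) (I l)).

Variables (T : 'I_t -> pzRingType)
  (lambda : forall l, {rmorphism quotient_ring (I l) -> T l}).

Definition eta (r : R) : product_ring T := fun l => lambda l (ring_proj (I l) r).

Lemma eta_zmod : zmod_morphism eta.
Proof. by move=> x y; apply: functional_extensionality_dep => l; rewrite /eta !rmorphB. Qed.

Lemma eta_monoid : monoid_morphism eta.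
Proof.
split=> [|x y]; apply: functional_extensionality_dep => l.
  by rewrite /eta !rmorph1.
by rewrite /eta !rmorphM.
Qed.

HB.instance Definition _ :=
  GRing.isZmodMorphism.Build R (product_ring T) eta eta_zmod.
HB.instance Definition _ :=
  GRing.isMonoidMorphism.Build R (product_ring T) eta eta_monoid.

Definition eta_morphism : {rmorphism R -> product_ring T} := eta.

(* The right R-module T / qT, where T is the product ring. *)
Definition theta_module (q : Spec (center (product_ring T))) : rmodType R :=
  quotient_module (ideal_submodule eta_morphism (extend q)).

End Setup.

Arguments factor_stratum {R t} I J l.

(* The right R-module structures on tensor products (Z(T)/b) (x)_Z(T) T for
   which (u (x) x) r = u (x) x f(r). *)
Definition is_base_change (R T : pzRingType) (f : {rmorphism R -> T})
    (b : ideal (center T)) (W : rmodType R)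
    (tau : quotient_module (ideal_left_submodule b) ->
           restrict_scalars (@center_val T) T^o -> W) :=
  is_tensor_product tau /\
  forall u (x : T) (r : R), tau u (x * f r) = (r : R^c) *: tau u x.

Arguments is_base_change {R T} f b W tau.

Definition jacobson_radical (R : pzRingType) : set R :=
  \bigcap_(P in @right_primitive R) P.
Arguments jacobson_radical R : clear implicits.

(* A [k]-algebra structure on [R] is a ring morphism [alg] from [k] to the
   center of [R]. *)
Definition nullstellensatz (k : fieldType) (R : pzRingType)
    (alg : {rmorphism k -> center R}) :=
  (forall M : rmodType R, simple_module M -> forall f : {linear M -> M},
     exists2 p : {poly k}, p != 0 &
       forall m : M,
         \sum_(i < size p) (center_val (alg p`_i) : R^c) *: iter i f m = 0) /\
  (forall A : ideal R, forall x, jacobson_radical (quotient_ring A) x ->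
     exists n, x ^+ n = 0).

(* Main.v *)
Require Import Defs.
From HB Require Import structures.
From mathcomp Require Import all_boot all_order all_algebra.
From mathcomp Require Import all_classical topology.

Set Implicit Arguments.
Unset Strict Implicit.
Unset Printing Implicit Defensive.

Import GRing.Theory.

Local Open Scope classical_set_scope.
Local Open Scope ring_scope.

(* Ideal commutativity of the [T l] passes to their product [T], so that [q] and
   [q T] determine each other, and [theta q] is the preimage of [q T] under
   [eta].  A prime of [T] is the preimage of a prime [p] of a single factor
   [T l].  Because [T l] is right noetherian, extension and contraction along
   the Ore localization match the primes of [T l] with the primes of
   [S l = R / I l] modulo which [D l] is regular, that is, by (B), with the
   points of the stratum [X l].  So [theta] restricts to an inclusion preserving
   bijection from the primes over [l] onto [X l].
   Local closedness passes from [X l] to [Spec R] because a prime of [R] above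
   [theta q] lies in [X l] or contains [J l], while [theta q] does not.
   If [q] is maximal, then [theta q] is locally closed, so were it not primitive
   the Jacobson radical of [R / theta q] would be a nonzero nil ideal; it blows
   up to the simple ring [T l / p], hence contains a unit.  If [theta q] is the
   annihilator of a simple module [M], then [z] in [Z], not in [q], induces an
   endomorphism of [M]; this is algebraic over [k], so [z] is invertible
   modulo [q]. *)

(** * Two-sided ideals, and primeness against central elements *)

Section IdealTheory.
Variable R : pzRingType.
Implicit Types A B P : ideal R.

Lemma idealB A x y : ideal_set A x -> ideal_set A y -> ideal_set A (x - y).
Proof. by move=> Ax Ay; apply: idealD => //; rewrite -mulN1r; exact: idealMl. Qed.

Lemma ideal_congr A x y : ideal_set A (x - y) -> ideal_set A x <-> ideal_set A y.
Proof.
move=> Axy; split=> [Ax|Ay]; last by rewrite -(subrK y x); exact: idealD.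
by rewrite -(subKr x y); exact: idealB.
Qed.

Lemma ideal_bigsum A (I : Type) (r : seq I) (F : I -> R) :
  (forall i, ideal_set A (F i)) -> ideal_set A (\sum_(i <- r) F i).
Proof.
by move=> AF; apply: big_ind => [|x y|i _]; [exact: ideal0|exact: idealD|].
Qed.

Lemma ideal_setT A : ideal_set A 1 -> ideal_set A = [set: R].
Proof.
by move=> A1; apply/seteqP; split=> // x _; rewrite -(mul1r x); exact: Defs.idealMr.
Qed.

Lemma ideal_mul_subP A B P :
  ideal_mul A B `<=` P <->
  forall a b, ideal_set A a -> ideal_set B b -> ideal_set P (a * b).
Proof.
split=> [sP a b Aa Bb|sP _ [s sAB ->]]; last first.
  rewrite big_seq; apply: big_ind => [|x y|p /sAB[Ap Bp]];
    [exact: ideal0|exact: idealD|exact: sP].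
apply: sP; exists [:: (a, b)]; last by rewrite big_seq1.
by move=> _ /[1!inE] /eqP ->.
Qed.

Lemma prime_ideal_not1 P : prime_ideal P -> ~ ideal_set P 1.
Proof. by move=> [nP _] /ideal_setT. Qed.

Lemma not_subset_exists (A P : set R) : ~ A `<=` P -> exists2 x, A x & ~ P x.
Proof.
move=> nAP; apply: contrapT => nex; apply: nAP => x Ax.
by apply: contrapT => nPx; apply: nex; exists x.
Qed.

Lemma prime_ideal_mul P A B : prime_ideal P -> ~ A `<=` P -> ~ B `<=` P ->
  exists2 x, ideal_set (ideal_mul A B) x & ~ ideal_set P x.
Proof.
by move=> [_ pP] nA nB; apply: not_subset_exists => /pP[].
Qed.

Section PrimeCentral.
Variables (P : ideal R) (c : R).
Hypotheses (pP : prime_ideal P) (cC : forall x, c * x = x * c).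

Definition central_colon : ideal R.
Proof.
apply: (@Ideal R [set b | ideal_set P (c * b)]) => /= [|x y|r x|r x].
- by rewrite mulr0; exact: ideal0.
- by rewrite mulrDr; exact: idealD.
- by move=> Px; rewrite mulrA cC -mulrA; exact: idealMl.
- by rewrite mulrA; exact: Defs.idealMr.
Defined.

Definition central_colon_annihilator : ideal R.
Proof.
apply: (@Ideal R [set a | forall b, ideal_set central_colon b -> ideal_set P (a * b)])
  => /= [b _|x y Px Py b cb|r x Px b cb|r x Px b cb].
- by rewrite mul0r; exact: ideal0.
- by rewrite mulrDl; apply: idealD; [exact: Px|exact: Py].
- by rewrite -mulrA; apply/idealMl/Px.
- by rewrite -mulrA; apply: Px; exact: (@idealMl _ central_colon).
Defined.

(** The left annihilator modulo [P] of the ideal of all [b] with [c * b] in [P] contains [c], and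
    the product of these two ideals lies in [P], so primeness for ideals decides. *)
Lemma prime_central w :
  ideal_set P (c * w) -> ideal_set P c \/ ideal_set P w.
Proof.
move=> Pcw; have [_ /(_ central_colon_annihilator central_colon)] := pP.
case; first by apply/ideal_mul_subP => a b; exact.
  by move=> sP; left; apply: sP => b.
by move=> sP; right; exact: sP.
Qed.

End PrimeCentral.

End IdealTheory.

(** * Contraction to the center and extension from it *)

Section CenterIdeals.
Variable R : pzRingType.
Implicit Types A P : ideal R.

Lemma extend_subP (B : ideal (center R)) A :
  extend B `<=` A <-> forall b, ideal_set B b -> ideal_set A (center_val b).
Proof.
split=> [sA b Bb|sA _ [s sB ->]]; last first.
  rewrite big_seq; apply: big_ind => [|x y|p /sB[[b Bb <-] _]];
    [exact: ideal0|exact: idealD|exact/Defs.idealMr/sA].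
apply: sA; exists [:: (center_val b, 1)]; last by rewrite big_seq1 mulr1.
by move=> _ /[1!inE] /eqP ->; split=> //; exists b.
Qed.

Lemma mem_extend (B : ideal (center R)) b :
  ideal_set B b -> ideal_set (extend B) (center_val b).
Proof. by move: b; apply/extend_subP. Qed.

Lemma centralC (z : center R) x : center_val z * x = x * center_val z.
Proof. by have /asboolP := center_valP z; exact. Qed.

Lemma center_eq (y z : center R) : center_val y = center_val z -> y = z.
Proof. exact: val_inj. Qed.

Lemma center_valD (y z : center R) : center_val (y + z) = center_val y + center_val z.
Proof. exact: rmorphD. Qed.

Lemma center_valM (y z : center R) : center_val (y * z) = center_val y * center_val z.
Proof. exact: rmorphM. Qed.

Lemma mem_contractM P (y z : center R) :
  ideal_set (contract P) (y * z) = ideal_set P (center_val y * center_val z).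
Proof. by rewrite -center_valM. Qed.

Lemma contract_prime P : prime_ideal P -> prime_ideal (contract P).
Proof.
move=> pP; split=> [cT|A B /ideal_mul_subP sP].
  by apply: (prime_ideal_not1 pP); have : ideal_set (contract P) 1 by rewrite cT.
have [|/not_subset_exists[a Aa nPa]] := pselect (A `<=` contract P); first by left.
right=> b Bb; have := sP a b Aa Bb; rewrite mem_contractM.
by case/(prime_central pP (centralC a)).
Qed.

Lemma subset_extend (B C : ideal (center R)) : B `<=` C -> extend B `<=` extend C.
Proof. by move=> sBC; apply/extend_subP => b /sBC; exact: mem_extend. Qed.

Section TwoSidedCancel.
Hypotheses (cK : cancel (@contract R) (@extend R)) (eK : cancel (@extend R) (@contract R)).

(** If [A B] lies in [extend q], the product of the contractions of [A] and [B] lies in [q]; one of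
    them is then inside [q], and extending it again gives back [A] or [B]. *)
Lemma extend_prime (q : ideal (center R)) : prime_ideal q -> prime_ideal (extend q).
Proof.
move=> pq; split=> [eT|A B sq].
  apply: (prime_ideal_not1 pq); rewrite -[q]eK.
  by change (ideal_set (extend q) 1); rewrite eT.
have [_ /(_ (contract A) (contract B))] := pq; case.
- apply/ideal_mul_subP => a b Aa Bb; rewrite -[q]eK mem_contractM.
  by move/ideal_mul_subP: sq; exact.
- by move=> /subset_extend; rewrite cK; left.
- by move=> /subset_extend; rewrite cK; right.
Qed.

End TwoSidedCancel.

End CenterIdeals.

(** * Transport of primes along surjective ring morphisms *)

Section Preimage.
Variables (R T : pzRingType) (f : {rmorphism R -> T}).

Definition preim_ideal (P : ideal T) : ideal R.
Proof.
apply: (@Ideal R (f @^-1` P)) => /= [|x y|r x|r x].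
- by rewrite rmorph0; exact: ideal0.
- by rewrite rmorphD; exact: idealD.
- by rewrite rmorphM; exact: idealMl.
- by rewrite rmorphM; exact: Defs.idealMr.
Defined.

Hypothesis f_surj : forall y, exists x, f x = y.

Definition image_ideal (A : ideal R) : ideal T.
Proof.
apply: (@Ideal T (f @` A)).
- by exists 0; [exact: ideal0|rewrite rmorph0].
- move=> _ _ [a Aa <-] [b Ab <-]; exists (a + b); first exact: idealD.
  by rewrite rmorphD.
- move=> y _ [a Aa <-]; have [r <-] := f_surj y.
  by exists (r * a); [exact: idealMl|rewrite rmorphM].
- move=> y _ [a Aa <-]; have [r <-] := f_surj y.
  by exists (a * r); [exact: Defs.idealMr|rewrite rmorphM].
Defined.

Lemma preim_prime P : prime_ideal P -> prime_ideal (preim_ideal P).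
Proof.
move=> [nP pP]; split=> [eT|A B sP].
  apply: nP; apply: ideal_setT; rewrite -(rmorph1 f).
  by change (ideal_set (preim_ideal P) 1); rewrite eT.
have [|sA|sB] := pP (image_ideal A) (image_ideal B).
- apply/ideal_mul_subP => _ _ [a Aa <-] [b Bb <-].
  by rewrite -rmorphM; move/ideal_mul_subP: sP; exact.
- by left=> a Aa; apply: sA; exists a.
- by right=> b Bb; apply: sB; exists b.
Qed.

Variable A : ideal R.
Hypothesis kerA : forall x, f x = 0 -> ideal_set A x.

Lemma image_idealP x : ideal_set (image_ideal A) (f x) <-> ideal_set A x.
Proof.
split=> [[a Aa fa]|Ax]; last by exists x.
by apply/(ideal_congr (y := a)) => //; apply: kerA; rewrite rmorphB fa subrr.
Qed.

Lemma image_prime : prime_ideal A -> prime_ideal (image_ideal A).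
Proof.
move=> pA; split=> [eT|B C sA].
  apply: (prime_ideal_not1 pA); apply/image_idealP; rewrite rmorph1.
  by rewrite eT.
have [_ /(_ (preim_ideal B) (preim_ideal C))] := pA; case.
- apply/ideal_mul_subP => b c Bb Cc; apply/image_idealP; rewrite rmorphM.
  by move/ideal_mul_subP: sA; exact.
- move=> sB; left=> y By; have [x ex] := f_surj y; exists x => //.
  by apply: sB; rewrite /= ex.
- move=> sC; right=> y Cy; have [x ex] := f_surj y; exists x => //.
  by apply: sC; rewrite /= ex.
Qed.

End Preimage.

(** * Ideals, center and primes of a finite product of rings *)

Section ProductRing.
Variables (t : nat) (T : 'I_t -> pzRingType).
Implicit Types (x y : product_ring T) (l m : 'I_t).

Definition product_proj l x : T l := x l.

Lemma product_proj_zmod l : zmod_morphism (product_proj l).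
Proof. by []. Qed.

Lemma product_proj_monoid l : monoid_morphism (product_proj l).
Proof. by []. Qed.

HB.instance Definition _ l :=
  GRing.isZmodMorphism.Build (product_ring T) (T l) (product_proj l)
    (product_proj_zmod l).
HB.instance Definition _ l :=
  GRing.isMonoidMorphism.Build (product_ring T) (T l) (product_proj l)
    (product_proj_monoid l).

(** Additive and multiplicative but not unital: [product_inj 1] is the central idempotent that cuts
    out the factor [l]. *)
Definition product_inj l (u : T l) : product_ring T :=
  eqtype.dfwith (fun m => 0 : T m) u.

Lemma product_injE l (u : T l) : product_inj u l = u.
Proof. exact: eqtype.dfwith_in. Qed.

Lemma product_inj_neq l m (u : T l) : l != m -> product_inj u m = 0.
Proof. exact: eqtype.dfwith_out. Qed.

Lemma product_ringP x y : (forall l, x l = y l) -> x = y.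
Proof. by move=> exy; apply: functional_extensionality_dep. Qed.

Lemma product_injD l (u v : T l) : product_inj (u + v) = product_inj u + product_inj v.
Proof.
apply: product_ringP => m; rewrite [RHS]/GRing.add /=.
have [<-|nlm] := eqVneq l m; first by rewrite /product_add !product_injE.
by rewrite /product_add !product_inj_neq // addr0.
Qed.

Lemma product_injMr l (u : T l) x : product_inj u * x = product_inj (u * x l).
Proof.
apply: product_ringP => m; rewrite [LHS]/GRing.mul /= /product_mul.
have [<-|nlm] := eqVneq l m; first by rewrite !product_injE.
by rewrite !product_inj_neq // mul0r.
Qed.

Lemma product_injMl l (u : T l) x : x * product_inj u = product_inj (x l * u).
Proof.
apply: product_ringP => m; rewrite [LHS]/GRing.mul /= /product_mul.
have [<-|nlm] := eqVneq l m; first by rewrite !product_injE.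
by rewrite !product_inj_neq // mulr0.
Qed.

Lemma product_inj0 l : product_inj (0 : T l) = 0.
Proof. by rewrite -[0 in LHS](mulr0 1) -(product_injMr _ 0) mulr0. Qed.

Lemma product_sum_inj x : x = \sum_l product_inj (x l).
Proof.
apply: product_ringP => m; rewrite -[RHS]/(product_proj m _) raddf_sum /=.
rewrite (bigD1 m) //= big1 ?addr0 => [|l nlm]; rewrite /product_proj.
  by rewrite product_injE.
by rewrite product_inj_neq.
Qed.

Definition product_ring_component l (A : ideal (product_ring T)) : ideal (T l).
Proof.
apply: (@Ideal _ [set u | ideal_set A (product_inj u)]) => /= [|u v|r u|r u].
- by rewrite product_inj0; exact: ideal0.
- by rewrite product_injD; exact: idealD.
- by move=> /(idealMl (product_inj r)); rewrite product_injMl product_injE.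
- by move=> /(Defs.idealMr (product_inj r)); rewrite product_injMr product_injE.
Defined.

Lemma mem_product_component l (A : ideal (product_ring T)) x :
  ideal_set A x -> ideal_set (product_ring_component l A) (x l).
Proof. by move=> /(idealMl (product_inj (1 : T l))); rewrite product_injMr mul1r. Qed.

Lemma product_idealP (A : ideal (product_ring T)) x :
  ideal_set A x <-> forall l, ideal_set (product_ring_component l A) (x l).
Proof.
split=> [Ax l|Ax]; first exact: mem_product_component.
by rewrite (product_sum_inj x); apply: ideal_bigsum => l; exact: Ax.
Qed.

Lemma product_centralP x :
  x \in @central (product_ring T) <-> forall l, x l \in @central (T l).
Proof.
split=> [/asboolP cx l|cx].
  apply/asboolP => u; have := congr1 (product_proj l) (cx (product_inj u)).
  by rewrite /product_proj product_injMl product_injMr !product_injE.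
apply/asboolP => y; apply: product_ringP => l.
by have /asboolP := cx l; exact.
Qed.

Lemma product_inj_central l (c : center (T l)) :
  product_inj (center_val c) \in @central (product_ring T).
Proof.
apply/product_centralP => m; have [<-|nlm] := eqVneq l m.
  by rewrite product_injE; exact: center_valP.
by rewrite product_inj_neq //; apply/asboolP => u; rewrite mul0r mulr0.
Qed.

Definition center_inj l (c : center (T l)) : center (product_ring T) :=
  Center (product_inj_central c).

Definition center_proj l (z : center (product_ring T)) : center (T l) :=
  Center ((product_centralP (center_val z)).1 (center_valP z) l).

Lemma center_injE l (c : center (T l)) :
  center_val (center_inj c) = product_inj (center_val c).
Proof. by []. Qed.

Lemma center_injM l (c : center (T l)) z :
  center_inj c * z = center_inj (c * center_proj l z).
Proof.
apply: center_eq; by rewrite center_valM !center_injE center_valM product_injMr.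
Qed.

Lemma center_injD l (c d : center (T l)) :
  center_inj (c + d) = center_inj c + center_inj d.
Proof.
by apply: center_eq; rewrite center_valD !center_injE center_valD product_injD.
Qed.

Lemma center_sum_inj (z : center (product_ring T)) :
  z = \sum_l center_inj (center_proj l z).
Proof.
apply: center_eq; rewrite (raddf_sum (@center_val (product_ring T))).
exact: product_sum_inj.
Qed.

Lemma center_inj0 l : center_inj (0 : center (T l)) = 0.
Proof. exact/center_eq/product_inj0. Qed.

Lemma center_projK l (c : center (T l)) : center_proj l (center_inj c) = c.
Proof. exact/center_eq/product_injE. Qed.

Lemma ideal_center_inj (B : ideal (center (product_ring T))) l (r c : center (T l)) :
  ideal_set B (center_inj c) -> ideal_set B (center_inj (r * c)).
Proof. by move=> /(idealMl (center_inj r)); rewrite center_injM center_projK. Qed.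

Definition center_component l (B : ideal (center (product_ring T))) :
  ideal (center (T l)).
Proof.
apply: (@Ideal _ [set c | ideal_set B (center_inj c)]) => /= [|c d|r c|r c].
- by rewrite center_inj0; exact: ideal0.
- by rewrite center_injD; exact: idealD.
- exact: ideal_center_inj.
- by rewrite mulrC; exact: ideal_center_inj.
Defined.

Section Cancellation.
Hypotheses (cK : forall l, cancel (@contract (T l)) (@extend (T l)))
  (eK : forall l, cancel (@extend (T l)) (@contract (T l))).

Lemma product_contractK : cancel (@contract (product_ring T)) (@extend (product_ring T)).
Proof.
move=> A; apply: ideal_eq; apply/seteqP; split; first by apply/extend_subP => b.
move=> x /product_idealP Ax; apply/product_idealP => l.
have : ideal_set (extend (contract (product_ring_component l A))) (x l).
  by rewrite cK; exact: Ax.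
move: (x l); apply/extend_subP => c Ac.
exact: (mem_extend (B := contract A) (b := center_inj c)).
Qed.

Lemma product_extendK : cancel (@extend (product_ring T)) (@contract (product_ring T)).
Proof.
move=> B; apply: ideal_eq; apply/seteqP; split; last by move=> b; exact: mem_extend.
move=> z eBz; rewrite (center_sum_inj z); apply: ideal_bigsum => l.
change (ideal_set (center_component l B) (center_proj l z)).
rewrite -(eK (center_component l B)).
have : extend B `<=` preim_ideal (@product_proj l) (extend (center_component l B)).
  apply/extend_subP => b Bb.
  apply: (mem_extend (b := center_proj l b)).
  rewrite /= -[center_proj l b]mul1r -center_injM; exact: idealMl.
by apply.
Qed.

End Cancellation.

Section ProductPrime.
Variable P : ideal (product_ring T).
Hypothesis pP : prime_ideal P.

Lemma product_prime_index : exists l, ~ ideal_set P (product_inj (1 : T l)).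
Proof.
apply: contrapT => nl; apply: (prime_ideal_not1 pP).
rewrite (product_sum_inj 1); apply: ideal_bigsum => l.
by apply: contrapT => nPl; apply: nl; exists l.
Qed.

Variable l : 'I_t.
Hypothesis Pl : ~ ideal_set P (product_inj (1 : T l)).

Lemma product_primeE : preim_ideal (@product_proj l) (product_ring_component l P) = P.
Proof.
apply: ideal_eq; apply/seteqP; split=> x; last exact: mem_product_component.
move=> Px; apply/product_idealP => m; have [<-//|nlm] := eqVneq l m.
(* The idempotent of [l] kills the other coordinates, so primeness, applied to this central
   idempotent outside [P], puts them all in [P]. *)
have e0 (y : product_ring T) : product_inj (1 : T l) * (y * product_inj (x m)) = 0.
  rewrite product_injMl product_injMr product_inj_neq ?mulr0 ?product_inj0 //.
  by rewrite eq_sym.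
have cl (y : product_ring T) : product_inj (1 : T l) * y = y * product_inj (1 : T l).
  by rewrite product_injMr product_injMl mul1r mulr1.
have := @prime_central _ _ _ pP cl (product_inj (x m)).
case=> //; rewrite -[product_inj (x m)]mul1r e0; exact: ideal0.
Qed.

Lemma product_component_prime : prime_ideal (product_ring_component l P).
Proof.
split=> [eT|A B sP].
  by apply: Pl; change (ideal_set (product_ring_component l P) 1); rewrite eT.
have sub (C : ideal (T l)) : preim_ideal (@product_proj l) C `<=` P ->
    C `<=` product_ring_component l P.
  by move=> sC u Cu; apply: sC; rewrite /= /product_proj product_injE.
have [_ /(_ (preim_ideal (@product_proj l) A) (preim_ideal (@product_proj l) B))] := pP.
case=> [|/sub|/sub]; [|by left|by right].
apply/ideal_mul_subP => a b Aa Bb; rewrite -product_primeE.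
by move/ideal_mul_subP: sP; exact.
Qed.

End ProductPrime.

Lemma product_proj_surj l (u : T l) : exists x, product_proj l x = u.
Proof. by exists (product_inj u); exact: product_injE. Qed.

End ProductRing.

(** * Ideals and primes in rings of right fractions *)

Lemma expr_right_inverse (S : pzRingType) (a b : S) n : a * b = 1 -> a ^+ n * b ^+ n = 1.
Proof.
move=> ab; elim: n => [|n IHn]; first by rewrite !expr0 mulr1.
by rewrite exprSr exprS -mulrA (mulrA a) ab mul1r.
Qed.

Section RightFractions.
Variables (R T : pzRingType) (D : set R) (f : {rmorphism R -> T}).

(** No condition is put on the kernel, so that both [S l -> T l] and the composite [R -> T l], which
    kills [I l], are instances. *)
Definition right_fractions :=
  [/\ D 1, forall c d, D c -> D d -> D (c * d),
      forall d, D d -> exists u, f d * u = 1 /\ u * f d = 1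
    & forall x, exists s d, D d /\ x * f d = f s].

Hypothesis fD : right_fractions.

Let D1 : D 1. Proof. by case: fD. Qed.
Let DM c d : D c -> D d -> D (c * d). Proof. by case: fD => _ + _ _; apply. Qed.
Let DU d : D d -> exists u, f d * u = 1 /\ u * f d = 1.
Proof. by case: fD => _ _ + _; apply. Qed.
Let fractionP x : exists s d, D d /\ x * f d = f s.
Proof. by case: fD. Qed.

Lemma fractions_ore r d : D d -> exists r' d', D d' /\ f r * f d' = f d * f r'.
Proof.
move=> Dd; have [u [du ud]] := DU Dd; have [r' [d' [Dd' er]]] := fractionP (u * f r).
by exists r', d'; split=> //; rewrite -er !mulrA du mul1r.
Qed.

Lemma ideal_fractionP (P : ideal T) x s d :
  D d -> x * f d = f s -> ideal_set P x <-> ideal_set P (f s).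
Proof.
move=> Dd exs; have [u [du _]] := DU Dd; split=> [Px|Ps].
  by rewrite -exs; exact: Defs.idealMr.
by rewrite -(mulr1 x) -du mulrA exs; exact: Defs.idealMr.
Qed.

Lemma preim_fractions_sub (P P' : ideal T) :
  preim_ideal f P `<=` preim_ideal f P' <-> P `<=` P'.
Proof.
split=> [sPP' x Px|sPP' x]; last exact: sPP'.
have [s [d [Dd exs]]] := fractionP x.
by apply/(ideal_fractionP P' Dd exs)/sPP'/(ideal_fractionP P Dd exs).
Qed.

Section LocalizedIdeal.
Variable N : ideal R.

(** The right ideal [f(N) T], as fractions with numerator in [N]; that it is also a left ideal comes
    from the chain condition on [T]. *)
Definition localized : set T :=
  [set x | exists n d, [/\ D d, ideal_set N n & x * f d = f n]].

Lemma localized0 : localized 0.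
Proof. by exists 0, 1; split; rewrite ?mul0r ?rmorph0 //; exact: ideal0. Qed.

Lemma localizedD x y : localized x -> localized y -> localized (x + y).
Proof.
move=> [n1 [d1 [Dd1 Nn1 e1]]] [n2 [d2 [Dd2 Nn2 e2]]].
have [r [d [Dd e]]] := fractions_ore d2 Dd1.
(* The Ore relation [f d2 * f d = f d1 * f r] makes [d2 * d] a common denominator. *)
exists (n1 * r + n2 * d), (d2 * d); split; first exact: DM.
  by apply: idealD; exact: Defs.idealMr.
rewrite mulrDl rmorphM [in X in X + _]e !mulrA e1 e2.
by rewrite rmorphD !rmorphM.
Qed.

Lemma localizedMr y x : localized x -> localized (x * y).
Proof.
move=> [n [d [Dd Nn e]]]; have [u [du ud]] := DU Dd.
have [s [d' [Dd' e']]] := fractionP (u * y).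
exists (n * s), d'; split=> //; first exact: Defs.idealMr.
by rewrite rmorphM -e' -e -!mulrA (mulrA (f d)) du mul1r.
Qed.

Lemma localizedMl_image r x : localized x -> localized (f r * x).
Proof.
move=> [n [d [Dd Nn e]]]; exists (r * n), d; split=> //; first exact: idealMl.
by rewrite -mulrA e rmorphM.
Qed.

Definition localized_chain (d : R) (n : nat) : submodule (T^c)^o.
Proof.
apply: (@Submodule T^c (T^c)^o [set x | localized (f d ^+ n * (x : T))]).
- by rewrite /= mulr0; exact: localized0.
- by move=> x y /= Lx Ly; rewrite mulrDr; exact: localizedD.
- by move=> a x /= Lx; have := localizedMr (a : T) Lx; rewrite -mulrA.
Defined.

Hypothesis noethT : right_noetherian T.

(* The right ideals [d^-n N T] form an ascending chain; where it becomes
   stationary, [d^-1 N T] is contained in [N T]. *)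
Lemma localizedMl_inverse d u x :
  D d -> u * f d = 1 -> f d * u = 1 -> localized x -> localized (u * x).
Proof.
move=> Dd ud du Lx.
have [|n stat] := noethT (N := localized_chain d).
  by move=> n y /= Ly; rewrite exprS -mulrA; exact: localizedMl_image.
have : submodule_set (localized_chain d n.+1) (u ^+ n.+1 * x).
  by rewrite /= mulrA expr_right_inverse // mul1r.
by rewrite stat //= exprSr -mulrA mulrA expr_right_inverse // mul1r.
Qed.

Definition localized_ideal : ideal T.
Proof.
apply: (@Ideal T localized localized0 localizedD) => [y x Lx|y x]; last exact: localizedMr.
have [s [d [Dd e]]] := fractionP y; have [u [du ud]] := DU Dd.
rewrite -(mulr1 y) -du mulrA e -mulrA.
exact/localizedMl_image/(localizedMl_inverse Dd).
Defined.

End LocalizedIdeal.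

Hypothesis noethT : right_noetherian T.

(** For [x = f a * u] with [u] inverse to a denominator, and [y] in [f(B) T], the element [u * y]
    stays in [f(B) T] because that is a left ideal, so [x * y] is a fraction with numerator in
    [A B]. *)
Lemma preim_fractions_prime (P : ideal T) :
  prime_ideal P -> prime_ideal (preim_ideal f P).
Proof.
move=> [nP pP]; split=> [eT|A B /ideal_mul_subP sP].
  apply: nP; apply: ideal_setT; rewrite -(rmorph1 f).
  by change (ideal_set (preim_ideal f P) 1); rewrite eT.
have sub (C : ideal R) : localized_ideal C noethT `<=` P -> C `<=` preim_ideal f P.
  by move=> sC c Cc; apply: sC; exists c, 1; rewrite rmorph1 mulr1.
have [|/sub|/sub] := pP (localized_ideal A noethT) (localized_ideal B noethT);
  [|by left|by right].
apply/ideal_mul_subP => x y [a [d [Dd Aa ex]]] Ly; have [u [du ud]] := DU Dd.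
rewrite -(mulr1 x) -du mulrA ex -mulrA.
have [b [d' [Dd' Bb eb]]] := localizedMl_inverse noethT Dd ud du Ly.
have e : f a * (u * y) * f d' = f (a * b) by rewrite -mulrA eb rmorphM.
by apply/(ideal_fractionP P Dd' e); exact: sP.
Qed.

Section Regular.
Variable Q : ideal R.
Hypotheses (kerQ : forall x, f x = 0 -> ideal_set Q x)
  (regQ : forall s d, D d -> ideal_set Q (s * d) -> ideal_set Q s).

Lemma preim_localized : preim_ideal f (localized_ideal Q noethT) = Q.
Proof.
apply: ideal_eq; apply/seteqP; split=> s; last first.
  by move=> Qs; exists s, 1; rewrite rmorph1 mulr1.
move=> [q [d [Dd Qq e]]]; apply: (regQ Dd).
by apply/(ideal_congr (y := q)) => //; apply: kerQ; rewrite rmorphB rmorphM e subrr.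
Qed.

(** Inclusions between ideals of [T] can be tested on preimages, and the localization of [Q] pulls
    back to [Q], so primeness carries up. *)
Lemma localized_prime : prime_ideal Q -> prime_ideal (localized_ideal Q noethT).
Proof.
move=> pQ; have [_ pQm] := pQ; split=> [eT|A B /ideal_mul_subP sQ].
  apply: (prime_ideal_not1 pQ); rewrite -preim_localized.
  by change (ideal_set (localized_ideal Q noethT) (f 1)); rewrite eT.
have [||] := pQm (preim_ideal f A) (preim_ideal f B); last 2 first.
- by rewrite -{1}preim_localized => /preim_fractions_sub; left.
- by rewrite -{1}preim_localized => /preim_fractions_sub; right.
apply/ideal_mul_subP => a b Aa Bb; rewrite -preim_localized /= rmorphM.
exact: sQ.
Qed.

End Regular.

(* A nil ideal modulo [P] that is nonzero would blow up to the whole simple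
   ring [T / P], hence would contain an element of [D], a unit of [T]. *)
Lemma maximal_fractions_not_nil (P : ideal T) (N : ideal R) :
  maximal_ideal P -> preim_ideal f P `<=` N ->
  (forall x, ideal_set N x -> exists n, ideal_set P (f x ^+ n)) ->
  N `<=` preim_ideal f P.
Proof.
move=> [nP maxP] sN nil; have [|eP|eT] := maxP (localized_ideal N noethT).
- move=> x Px; have [s [d [Dd e]]] := fractionP x.
  by exists s, d; split=> //; apply: sN; apply/(ideal_fractionP P Dd e).
- by move=> x Nx; rewrite /= -eP; exists x, 1; rewrite rmorph1 mulr1.
have [n [d [Dd Nn]]] : ideal_set (localized_ideal N noethT) 1 by rewrite eT.
rewrite mul1r => e; have [k] := nil _ Nn; rewrite -e => Pdk.
have [u [du _]] := DU Dd; case: nP; apply: ideal_setT.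
elim: k Pdk => [|k IHk]; first by rewrite expr0.
rewrite exprSr => /(Defs.idealMr u); rewrite -mulrA du mulr1; exact: IHk.
Qed.

End RightFractions.

(** * The endomorphism of a simple module induced by a central element *)

Section CentralAction.
Variables (R T : pzRingType) (D : set R) (f : {rmorphism R -> T}).
Hypothesis fD : right_fractions D f.
Variables (P : ideal T) (pP : prime_ideal P) (M : rmodType R).
Hypotheses (simM : simple_module M) (annM : preim_ideal f P = annihilator M :> set R).
Variable z : T.
Hypothesis cz : forall x, z * x = x * z.

Local Notation "m ** r" := (((r : R) : R^c) *: (m : M)) (at level 40, left associativity).

Lemma act_annP r : (forall m : M, m ** r = 0) <-> ideal_set P (f r).
Proof. by change (annihilator M r <-> ideal_set (preim_ideal f P) r); rewrite annM. Qed.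

Lemma actM (m : M) r s : m ** r ** s = m ** (r * s).
Proof. exact: scalerA. Qed.

Lemma act_congr (m : M) r s : ideal_set P (f r - f s) -> m ** r = m ** s.
Proof.
rewrite -rmorphB => /act_annP /(_ m) /eqP.
by rewrite -[(r - s : R) : R^c]/((r : R^c) - (s : R^c)) scalerBl subr_eq0 => /eqP.
Qed.

(* [T] need not act on [M], but the central element [z] does: the relation
   below, "[m' = m z]", is the graph of an endomorphism of [M], as in the
   construction of the extended centroid. *)
Definition central_graph (m m' : M) :=
  forall c s, ideal_set P (z * f c - f s) -> m' ** c = m ** s.

(** A denominator is a unit of [T], so if it killed [M] its image, and then [1], would lie in
    [P]. *)
Lemma denominator_act d : D d -> exists m : M, m ** d <> 0.
Proof.
case: (fD) => _ _ /(_ d) DU _ /DU[u [du _]]; apply: contrapT => nex.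
apply: (prime_ideal_not1 pP); rewrite -du; apply: Defs.idealMr; apply/act_annP => m.
by apply: contrapT => md; apply: nex; exists m.
Qed.

Lemma central_fraction : exists s d, D d /\ z * f d = f s.
Proof. by case: fD. Qed.

Lemma central_graph_unique m m1 m2 :
  central_graph m m1 -> central_graph m m2 -> m1 = m2.
Proof.
move=> g1 g2; have [s [d [Dd e]]] := central_fraction.
(* Elements killed by every [c] for which [z * f c] comes from [R] modulo [P]: a submodule
   containing [m1 - m2], and proper because a denominator of [z] is such a [c]. *)
pose C := [set m : M | forall c s, ideal_set P (z * f c - f s) -> m ** c = 0].
have C0 : C 0 by move=> c s' _; rewrite scaler0.
have CD x y : C x -> C y -> C (x + y).
  by move=> Cx Cy c s' zcs; rewrite scalerDr (Cx c s') // (Cy c s') // addr0.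
have CZ (r : R) x : C x -> C (x ** r).
  move=> Cx c s' zcs; rewrite actM; apply: (Cx _ (r * s')).
  by rewrite !rmorphM mulrA cz -mulrA -mulrBr; exact: idealMl.
have zds : ideal_set P (z * f d - f s) by rewrite e subrr; exact: ideal0.
have [_ /(_ (Submodule C0 CD CZ)) /= [C_0|CT]] := simM.
  have : C (m1 - m2) by move=> c s' zcs; rewrite scalerBr (g1 c s') // (g2 c s') // subrr.
  by rewrite C_0 => /eqP; rewrite subr_eq0 => /eqP.
have [m0] := denominator_act Dd; have : C m0 by rewrite CT.
by move=> /(_ d s zds).
Qed.

Lemma central_graphD m1 m2 n1 n2 : central_graph m1 n1 -> central_graph m2 n2 ->
  central_graph (m1 + m2) (n1 + n2).
Proof.
by move=> g1 g2 c s zcs; rewrite !scalerDr (g1 c s zcs) (g2 c s zcs).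
Qed.

Lemma central_graphZ (r : R) m n : central_graph m n -> central_graph (m ** r) (n ** r).
Proof.
move=> g c s zcs; rewrite !actM; apply: g.
by rewrite !rmorphM mulrA cz -mulrA -mulrBr; exact: idealMl.
Qed.

Lemma central_graph_total m : exists m', central_graph m m'.
Proof.
pose G := [set m | exists m', central_graph m m'].
have G0 : G 0 by exists 0 => c s _; rewrite !scaler0.
have GD x y : G x -> G y -> G (x + y).
  by move=> [x' gx] [y' gy]; exists (x' + y'); exact: central_graphD.
have GZ (r : R) x : G x -> G (x ** r).
  by move=> [x' gx]; exists (x' ** r); exact: central_graphZ.
have [_ /(_ (Submodule G0 GD GZ)) /= [G_0|GT]] := simM; last first.
  by have : G m by rewrite GT.
(* Since [z * f d = f s0], the image of [m0 ** d] has to be [m0 ** s0]; choosing [m0 ** d] nonzero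
   makes [G] all of [M]. *)
have [s0 [d [Dd e]]] := central_fraction; have [m0] := denominator_act Dd.
suff : G (m0 ** d) by rewrite G_0.
exists (m0 ** s0) => c s zcs; rewrite !actM; apply: act_congr.
by rewrite !rmorphM -e cz -mulrA -mulrBr; exact: idealMl.
Qed.

Definition central_act (m : M) : M := projT1 (cid (central_graph_total m)).

Lemma central_actP m : central_graph m (central_act m).
Proof. by rewrite /central_act; case: cid. Qed.

Lemma central_act_linear : linear central_act.
Proof.
move=> a x y; apply: (central_graph_unique (central_actP _)).
by apply: central_graphD; [apply: central_graphZ|]; exact: central_actP.
Qed.

HB.instance Definition _ :=
  GRing.isLinear.Build R^c M M *:%R central_act central_act_linear.

Lemma central_act_fraction s d m i : z * f d = f s ->
  iter i central_act m ** (d ^+ i) = m ** (s ^+ i).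
Proof.
move=> e; elim: i m => [|i IHi] m; first by rewrite !expr0.
rewrite iterSr !exprSr -actM IHi -linearZ /= -actM; apply: central_actP.
by rewrite e subrr; exact: ideal0.
Qed.

(** Multiplying the relation on [M] by [d ^+ n] turns it into an element of [R] that annihilates
    [M]; its image lies in [P], where the unit [f d ^+ n] cancels. *)
Lemma central_act_poly n (a : nat -> R) : (forall i x, a i * x = x * a i) ->
  (forall m : M, \sum_(i < n) iter i central_act m ** a i = 0) ->
  ideal_set P (\sum_(i < n) f (a i) * z ^+ i).
Proof.
move=> ca az; have [s [d [Dd e]]] := central_fraction.
(* The [i]-th term cleared by [d ^+ n]: [i] of the factors [d] turn [z ^+ i] into [s ^+ i], and
   [n - i] are left over. *)
pose r i : R := s ^+ i * d ^+ (n - i) * a i.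
have Pr : ideal_set P (f (\sum_(i < n) r i)).
  apply/act_annP => m.
  rewrite -[X in X *: _]/(\sum_(i < n) (r i : R^c)) scaler_suml.
  transitivity ((\sum_(i < n) iter i central_act m ** a i) ** (d ^+ n)); last first.
    by rewrite az scaler0.
  rewrite scaler_sumr; apply: eq_bigr => i _.
  rewrite -!actM -(central_act_fraction _ _ e) !actM mulrA -exprD subnKC ?ca //.
  exact: ltnW.
have cX k x : z ^+ k * x = x * z ^+ k.
  by apply: commr_sym; apply: commrX => //; rewrite /GRing.comm cz.
have er : f (\sum_(i < n) r i) = f d ^+ n * \sum_(i < n) f (a i) * z ^+ i.
  rewrite rmorph_sum mulr_sumr; apply: eq_bigr => i _.
  rewrite /r !rmorphM !rmorphXn -e exprMn_comm; last exact: cz.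
  rewrite -!mulrA (mulrA (f d ^+ i)) -exprD subnKC; last exact: ltnW.
  by rewrite cX mulrA.
case: fD => _ _ /(_ d Dd)[u [du ud]] _.
rewrite -[X in ideal_set P X]mul1r -(expr_right_inverse n ud) -mulrA -er.
exact: idealMl.
Qed.

End CentralAction.

(** * Points of spectra, quotients and primitive ideals *)

Lemma ideal_point_eq (R : pzRingType) (C : set (ideal R)) (P Q : ideal_point C) :
  P = Q :> set R -> P = Q.
Proof.
case: P Q => [P CP] [Q CQ] /= /ideal_eq ePQ; subst Q.
by congr IdealPoint; exact: Prop_irrelevance.
Qed.

(** The inclusion of [P] in the intersection is automatic, so one element witnessing strictness is
    enough, and such witnesses can be transported along [theta]. *)
Lemma locally_closedP (R : pzRingType) (P : Spec R) :
  locally_closed P <-> exists2 x, ~ ideal_set P x &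
    forall Q : Spec R, (P : set R) `<` Q -> ideal_set Q x.
Proof.
split=> [[_ /not_subset_exists[x QP nPx]]|[x nPx Qx]]; first by exists x.
split; first by move=> y Py Q [+ _]; exact.
by move=> sQP; apply: nPx; apply: sQP => Q; exact: Qx.
Qed.

Section QuotientModules.
Variables (K : pzRingType) (M : lmodType K) (N : submodule M).

Lemma module_projZ (a : K) x : a *: module_proj N x = module_proj N (a *: x).
Proof. exact: quotient_scaleE. Qed.

Lemma module_proj_eq0 x : module_proj N x = 0 <-> submodule_set N x.
Proof.
have <- : module_proj N 0 = 0 by rewrite -(scale0r (0 : M)) -module_projZ scale0r.
by rewrite module_projE subr0.
Qed.

End QuotientModules.

Section QuotientMaps.
Variables (R : pzRingType) (A : ideal R).

Lemma ring_proj_surj (u : quotient_ring A) : exists x, ring_proj A x = u.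
Proof. by have [x ->] := ring_projP u; exists x. Qed.

Lemma ring_proj_eq0 x : ring_proj A x = 0 <-> ideal_set A x.
Proof. by rewrite -(rmorph0 (ring_proj A)) ring_projE subr0. Qed.

Lemma regular_moduloP d : regular_modulo A d <->
  (forall x, ideal_set A (d * x) -> ideal_set A x) /\
  (forall x, ideal_set A (x * d) -> ideal_set A x).
Proof.
split=> [[ld rd]|[ld rd]]; split.
- move=> x /ring_proj_eq0; rewrite rmorphM -(mulr0 (ring_proj A d)).
  by move=> /ld /ring_proj_eq0.
- move=> x /ring_proj_eq0; rewrite rmorphM -(mul0r (ring_proj A d)).
  by move=> /rd /ring_proj_eq0.
- move=> u v; have [x <-] := ring_proj_surj u; have [y <-] := ring_proj_surj v.
  by rewrite -!rmorphM => /ring_projE; rewrite -mulrBr => /ld /ring_projE.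
- move=> u v; have [x <-] := ring_proj_surj u; have [y <-] := ring_proj_surj v.
  by rewrite -!rmorphM => /ring_projE; rewrite -mulrBl => /rd /ring_projE.
Qed.

End QuotientMaps.

Lemma preim_primitive (R S : pzRingType) (f : {rmorphism R -> S}) (P : ideal S) :
  (forall y, exists x, f x = y) -> right_primitive P ->
  right_primitive (preim_ideal f P).
Proof.
move=> f_surj [M [[m m0] simM] eP].
exists (restrict_scalars (converse_rmorphism f) M); last first.
  apply/seteqP; split=> [x Px|x ax].
    by have : annihilator M (f x) by rewrite -eP.
  by change (ideal_set P (f x)); rewrite eP.
split=> [|N]; first by exists m.
have NZ (a : S^c) (x : M) : submodule_set N x -> submodule_set N (a *: x).
  by have [r <-] := f_surj (a : S); exact: (@submoduleZ _ _ N (r : R^c) x).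
exact: (simM (@Submodule S^c M N (submodule0 N) (@submoduleD _ _ N) NZ)).
Qed.

(** Induction over the coefficients: if the lowest one is zero, [z], central and outside [P], is
    cancelled by primeness; if not, its image under [g] lies in [A] because the remaining terms are
    multiples of [z]. *)
Lemma central_poly_mem (S : pzRingType) (k : fieldType) (g : k -> S) (A P : ideal S)
    (z : S) (s : seq k) :
  prime_ideal P -> P `<=` A -> ideal_set A z -> ~ ideal_set P z ->
  (forall x, z * x = x * z) -> g 0 = 0 ->
  (forall c, c != 0 -> ideal_set A (g c) -> ideal_set A 1) ->
  has (fun c => c != 0) s -> ideal_set P (\sum_(i < size s) g s`_i * z ^+ i) ->
  ideal_set A 1.
Proof.
move=> pP sPA Az nPz cz g0 gA; elim: s => [//|c s IHs] /=.
rewrite big_ord_recl /= expr0 mulr1.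
set w := \sum_(i < _) _; have -> : w = z * \sum_(i < size s) g s`_i * z ^+ i.
  rewrite mulr_sumr; apply: eq_bigr => i _.
  by rewrite cz -mulrA -exprSr.
have [->/=|c0 _ Pcw] := eqVneq c 0.
  by rewrite g0 add0r => hs /(prime_central pP cz)[//|]; exact: IHs.
apply: (gA c c0); apply/(ideal_congr (y := 0)); last exact: ideal0.
rewrite subr0; move/sPA : Pcw.
set w' := \sum_(i < _) _ => Acw; rewrite -(addrK (z * w') (g c)).
by apply: idealB => //; exact: Defs.idealMr.
Qed.

(** * Primes of [T l], strata, and the map [theta] *)

Section Theta.
Variables (R : pzRingType) (t : nat) (I J : 'I_t -> ideal R)
  (D : forall l : 'I_t, set (quotient_ring (I l))).
Arguments D : clear implicits.
Variables (T : 'I_t -> pzRingType)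
  (lambda : forall l : 'I_t, {rmorphism quotient_ring (I l) -> T l}).
Hypotheses
  (specR : [set: Spec R] = \bigcup_(l in [set: 'I_t]) stratum I J l)
  (denominators : forall l, right_denominator_set (D l))
  (localizations : forall l, right_ore_localization (D l) (lambda l))
  (hA : forall l, right_noetherian (T l))
  (hB : forall l, factor_stratum I J l =
          [set Q : Spec (quotient_ring (I l)) | D l `<=` regular_modulo Q])
  (hC : forall l, ideally_commutative (T l)).
Arguments hA : clear implicits.

Local Notation TT := (product_ring T).
Local Notation ZZ := (center (product_ring T)).
Local Notation eta := (eta_morphism lambda).

Definition component_map l : {rmorphism R -> T l} := lambda l \o ring_proj (I l).

Lemma fractions_factor l : right_fractions (D l) (lambda l).
Proof.
have [[D1 DM _] _] := denominators l; have [U F _] := localizations l.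
by split.
Qed.

Lemma fractions_component l :
  right_fractions (ring_proj (I l) @^-1` D l) (component_map l).
Proof.
have [D1 DM U F] := fractions_factor l; split=> /=.
- by rewrite rmorph1.
- by move=> c d Dc Dd; rewrite rmorphM; exact: DM.
- by move=> d; exact: U.
- move=> x; have [s [d [Dd e]]] := F x.
  have [r er] := ring_proj_surj s; have [c ec] := ring_proj_surj d.
  by exists r, c; rewrite /= ec er.
Qed.

Lemma component_map0 l x : ideal_set (I l) x -> component_map l x = 0.
Proof. by move=> /ring_proj_eq0 /= ->; rewrite rmorph0. Qed.

Lemma lambda_eq0 l s : lambda l s = 0 -> s = 0.
Proof.
have [_ _ ker] := localizations l; have [_ reg] := denominators l.
move=> /ker[d Dd sd]; have [_ rd] := reg d Dd; apply: rd.
by rewrite /= sd mul0r.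
Qed.

(** Denominators are units of [T l], hence regular modulo any prime contracted from [T l], so (B)
    puts the contraction to [S l] in [factor_stratum]. *)
Lemma preim_component_stratum l (p : ideal (T l)) (Q : Spec R) : prime_ideal p ->
  Q = preim_ideal (component_map l) p :> ideal R -> stratum I J l Q.
Proof.
move=> pp eQ; pose QS : Spec (quotient_ring (I l)) :=
  IdealPoint (preim_fractions_prime (fractions_factor l) (hA l) pp).
have : factor_stratum I J l QS.
  rewrite hB => d Dd; apply/regular_moduloP.
  have [_ _ /(_ d Dd)[u [du ud]] _] := fractions_factor l.
  split=> x /=; rewrite rmorphM.
    by move=> /(idealMl u); rewrite mulrA ud mul1r.
  by move=> /(Defs.idealMr u); rewrite -mulrA du mulr1.
move=> nQS; split; rewrite /zariski_V /= eQ.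
  by move=> x /component_map0 /= ->; exact: ideal0.
move=> sJ; apply: nQS => _ [_ [j Jj [i Ii <-]] <-] /=; rewrite rmorphD rmorphD.
by apply: idealD; [exact: sJ|have := component_map0 Ii => /= ->; exact: ideal0].
Qed.

(** [Q / I l] is a prime of [S l] in [factor_stratum], so by (B) the elements of [D l] are regular
    modulo it; its localization is then a prime of [T l] that contracts back to it. *)
Lemma stratum_preim_component l (Q : Spec R) : stratum I J l Q ->
  exists2 p : ideal (T l), prime_ideal p & Q = preim_ideal (component_map l) p :> ideal R.
Proof.
move=> [IQ nJQ].
have kQ x : ring_proj (I l) x = 0 -> ideal_set Q x by move=> /ring_proj_eq0; exact: IQ.
pose QS := image_ideal (@ring_proj_surj _ (I l)) Q.
have pQS : prime_ideal QS := image_prime (@ring_proj_surj _ (I l)) kQ (point_idealP Q).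
have : factor_stratum I J l (IdealPoint pQS).
  move=> sJ; apply: nJQ => j Jj; apply/(image_idealP (@ring_proj_surj _ (I l)) kQ).
  by apply: sJ; exists j => //; exists j => //; exists 0; [exact: ideal0|rewrite addr0].
rewrite hB => DQ.
have kQS s : lambda l s = 0 -> ideal_set QS s by move=> /lambda_eq0 ->; exact: ideal0.
have rQS s d : D l d -> ideal_set QS (s * d) -> ideal_set QS s.
  by move=> /DQ /regular_moduloP[_]; exact.
exists (localized_ideal (fractions_factor l) QS (hA l)); first exact: localized_prime.
apply: ideal_eq; apply/seteqP; split=> x Qx.
  pose L := localized_ideal (fractions_factor l) QS (hA l).
  change (ideal_set (preim_ideal (lambda l) L) (ring_proj (I l) x)).
  by rewrite preim_localized //; exists x.
apply/(image_idealP (@ring_proj_surj _ (I l)) kQ).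
change (ideal_set QS (ring_proj (I l) x)).
by rewrite -(preim_localized (fractions_factor l) (hA l) kQS rQS).
Qed.

Let TcK : cancel (@contract TT) (@extend TT).
Proof. by apply: product_contractK => l; have [] := hC l. Qed.

Let TeK : cancel (@extend TT) (@contract TT).
Proof. by apply: product_extendK => l; have [] := hC l. Qed.

Lemma mem_extendP (B : ideal ZZ) z : ideal_set (extend B) (center_val z) <-> ideal_set B z.
Proof. by rewrite -[in X in _ <-> X](TeK B). Qed.

Lemma contract_subP (A : ideal TT) (B : ideal ZZ) : contract A `<=` B <-> A `<=` extend B.
Proof.
split=> [/subset_extend|sAB z /= Az]; first by rewrite TcK.
by apply/mem_extendP; exact: sAB.
Qed.

Lemma extend_Spec_prime (q : Spec ZZ) : prime_ideal (extend q).
Proof. exact (extend_prime TcK TeK (point_idealP q)). Qed.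

(** The prime [q T] comes from the factor [l], whose idempotent it avoids; it contains the
    idempotents of all other factors. *)
Definition lies_over l (q : Spec ZZ) := ~ ideal_set (extend q) (product_inj (1 : T l)).

Lemma lies_over_exists q : exists l, lies_over l q.
Proof. exact (product_prime_index (extend_Spec_prime q)). Qed.

Local Notation component l q := (product_ring_component l (extend q)).

Lemma component_prime l q : lies_over l q -> prime_ideal (component l q).
Proof. by move=> lq; apply: product_component_prime => //; exact: extend_Spec_prime. Qed.

Lemma preim_eta_extend l q : lies_over l q ->
  preim_ideal eta (extend q) = preim_ideal (component_map l) (component l q).
Proof.
move=> lq; apply: ideal_eq.
by rewrite -{1}(product_primeE (extend_Spec_prime q) lq).
Qed.

Lemma theta_prime (q : Spec ZZ) : prime_ideal (preim_ideal eta (extend q)).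
Proof.
have [l lq] := lies_over_exists q; rewrite (preim_eta_extend lq).
exact (preim_fractions_prime (fractions_component l) (hA l) (component_prime lq)).
Qed.

Definition theta (q : Spec ZZ) : Spec R := IdealPoint (theta_prime q).

Lemma thetaE l q : lies_over l q ->
  theta q = preim_ideal (component_map l) (component l q) :> ideal R.
Proof. exact: preim_eta_extend. Qed.

Lemma component_sub l (q q' : Spec ZZ) : lies_over l q -> lies_over l q' ->
  component l q `<=` component l q' <-> q `<=` q'.
Proof.
move=> lq lq'; split=> [sqq' z qz|sqq' u]; last exact: subset_extend.
apply/mem_extendP; rewrite -(product_primeE (extend_Spec_prime q') lq').
by apply: sqq'; apply: mem_product_component; exact: mem_extend.
Qed.

(** Over one factor, inclusions are unchanged by passing to components in [T l], and ideals of [T l]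
    are compared through their preimages in [R]. *)
Lemma theta_sub l (q q' : Spec ZZ) : lies_over l q -> lies_over l q' ->
  theta q `<=` theta q' <-> q `<=` q'.
Proof.
move=> lq lq'; rewrite (thetaE lq) (thetaE lq') -(component_sub lq lq').
exact (preim_fractions_sub (fractions_component l) _ _).
Qed.

Lemma lies_over_sub l (q q' : Spec ZZ) : q `<=` q' -> lies_over l q' -> lies_over l q.
Proof. by move=> /subset_extend sqq' lq' /sqq'. Qed.

Lemma lies_over_subE l (q q' : Spec ZZ) : q `<=` q' -> lies_over l q -> lies_over l q'.
Proof.
move=> sqq' lq; have [m lq'] := lies_over_exists q'.
(* If [q'] lay over another factor [m], so would [q]; but [q T], being pulled back from the factor
   [l], contains the idempotent of [m]. *)
have [->//|nlm] := eqVneq l m; case: (lies_over_sub sqq' lq').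
rewrite -(product_primeE (extend_Spec_prime q) lq) /= /product_proj.
rewrite (product_inj_neq (l := m)) 1?eq_sym // product_inj0.
exact: (@ideal0 _ (extend q)).
Qed.

Lemma theta_inj_over l q q' : lies_over l q -> lies_over l q' ->
  theta q = theta q' -> q = q'.
Proof.
move=> lq lq' e; apply: ideal_point_eq; apply/seteqP.
by split; [apply/(theta_sub lq lq')|apply/(theta_sub lq' lq)]; rewrite e.
Qed.

Lemma theta_stratum l q : lies_over l q -> stratum I J l (theta q).
Proof.
move=> lq; exact (preim_component_stratum (component_prime lq) (thetaE lq)).
Qed.

Lemma stratum_theta l Q : stratum I J l Q -> exists2 q, lies_over l q & theta q = Q.
Proof.
move=> /stratum_preim_component[p pp eQ].
pose P := preim_ideal (@product_proj _ T l) p.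
have pP : prime_ideal P := preim_prime (@product_proj_surj _ T l) pp.
pose q : Spec ZZ := IdealPoint (contract_prime pP).
have eq : extend q = P := TcK P.
exists q.
  rewrite /lies_over eq /= /product_proj product_injE; exact: prime_ideal_not1.
apply: ideal_point_eq; rewrite eQ.
change (preim_ideal eta (extend q) = preim_ideal (component_map l) p :> set R).
by rewrite eq.
Qed.

Lemma theta_surj Q : exists q, theta q = Q.
Proof.
have : [set: Spec R] Q by [].
by rewrite specR => -[l _ /stratum_theta[q _ <-]]; exists q.
Qed.

(** By injectivity over each of the [t] factors, a fiber has at most one point over each. *)
Lemma theta_finite P : finite_set [set q | theta q = P].
Proof.
have -> : [set q | theta q = P] =
    \bigcup_(l in [set: 'I_t]) [set q | lies_over l q /\ theta q = P].
  apply/seteqP; split=> [q eq|q [l _ [_ eq]] //].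
  by have [l lq] := lies_over_exists q; exists l.
apply: bigcup_finite => // l _.
have [->//|/set0P[q0 [lq0 e0]]] := eqVneq [set q | lies_over l q /\ theta q = P] set0.
apply: sub_finite_set (finite_set1 q0) => q [lq e].
by apply: (theta_inj_over lq lq0); rewrite e e0.
Qed.

Lemma theta_bij : trivIset [set: 'I_t] (stratum I J) -> bijective theta.
Proof.
move=> triv; have inj q q' : theta q = theta q' -> q = q'.
  move=> e; have [l lq] := lies_over_exists q; have [m lq'] := lies_over_exists q'.
  have elm : l = m.
    apply: triv => //; exists (theta q); split; first exact: theta_stratum.
    by rewrite e; exact: theta_stratum.
  by subst m; exact: (theta_inj_over lq lq').
have [g gK] := choice theta_surj.
by exists g => // q; apply: inj; rewrite gK.
Qed.

(** * Continuity and local closedness *)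

Lemma theta_VP (E : set R) (q : Spec ZZ) :
  E `<=` theta q <-> contract (generated_ideal (eta @` E)) `<=` q.
Proof.
split=> [sE|/contract_subP/generated_ideal_sub sE x Ex]; last first.
  by apply: sE; exists x.
by apply/contract_subP/generated_ideal_sub => _ [x Ex <-]; exact: sE.
Qed.

Lemma theta_continuous : continuous theta.
Proof.
apply/continuousP => U; rewrite !Spec_openE => -[E ->].
(* By [theta_VP], the preimage of the closed set of [E] is the closed set of the contraction of the
   ideal generated by [eta E]. *)
exists (contract (generated_ideal (eta @` E))).
rewrite preimage_setC; congr setC; apply/seteqP.
by split=> q /theta_VP.
Qed.

Lemma theta_locally_closed q : locally_closed (theta q) <-> locally_closed q.
Proof.
have [l lq] := lies_over_exists q.
split=> /locally_closedP[x nx xQ]; apply/locally_closedP; last first.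
- have nPx : ~ ideal_set (component l q) (center_val x l).
    move=> Px; apply: nx; apply/mem_extendP.
    by rewrite -(product_primeE (extend_Spec_prime q) lq).
  have [_ _ _ F] := fractions_component l.
  (* The numerator [s] is outside [theta q] but in every larger prime of [X l]; it is absorbed into
     an ideal [B] so that [B] can be multiplied with [J l]. *)
  have [s [d [Dd e]]] := F (center_val x l).
  have [_ nJ] := theta_stratum lq.
  pose B := [set b | forall Q : Spec R, stratum I J l Q -> (theta q : set R) `<` Q ->
                     ideal_set Q b].
  have B0 : B 0 by move=> Q _ _; exact: ideal0.
  have BD a b : B a -> B b -> B (a + b).
    by move=> Ba Bb Q lQ qQ; apply: idealD; [exact: Ba|exact: Bb].
  have Bl r b : B b -> B (r * b) by move=> Bb Q lQ qQ; apply/idealMl/Bb.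
  have Br r b : B b -> B (b * r) by move=> Bb Q lQ qQ; apply/Defs.idealMr/Bb.
  have nB : ~ Ideal B0 BD Bl Br `<=` theta q.
    move=> /(_ s) /= sB; apply: nPx; apply/(ideal_fractionP (fractions_component l) _ Dd e).
    change (ideal_set (preim_ideal (component_map l) (component l q)) s).
    rewrite -(thetaE lq); apply: sB => Q /stratum_theta[q' lq' <-] [sqq' nqq'].
    rewrite (thetaE lq'); apply/(ideal_fractionP (fractions_component l) _ Dd e).
    apply/mem_product_component/mem_extend/xQ.
    by split; [apply/(theta_sub lq lq')|move=> /(theta_sub lq' lq)].
  (* A prime strictly above [theta q] contains [J l], or belongs to [X l] and contains [B]; either
     way it contains their product, so an element of the product outside [theta q] is a witness. *)
  have [b Bb nb] := prime_ideal_mul (point_idealP (theta q)) nB nJ.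
  exists b => // Q qQ; have [sqQ _] := qQ.
  have [JQ|nJQ] := pselect (J l `<=` Q).
    move: b Bb {nb}; apply/ideal_mul_subP => a j _ Jj.
    exact/idealMl/JQ.
  have lQ : stratum I J l Q.
    by split=> //; apply: subset_trans sqQ; have [] := theta_stratum lq.
  by move: b Bb {nb}; apply/ideal_mul_subP => a j Ba _; exact/Defs.idealMr/Ba.
(* A larger [q'] lies over the same factor, so [theta q'] is strictly larger and contains [x]; hence
   [q'] contains the contraction of the ideal generated by [eta x], which [q] does not. *)
- have /not_subset_exists[z Az nqz] :
      ~ contract (generated_ideal [set eta x]) `<=` q.
    by move=> /contract_subP/generated_ideal_sub sx; apply: nx; exact: sx.
  exists z => // q' [sqq' nqq'].
  suff : contract (generated_ideal [set eta x]) `<=` q' by exact.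
  apply/contract_subP/generated_ideal_sub => _ ->.
  have lq' := lies_over_subE sqq' lq.
  change (ideal_set (theta q') x); apply: xQ.
  by split; [apply/(theta_sub lq lq')|move=> /(theta_sub lq' lq)].
Qed.

(** * Descriptions of [theta q] as an annihilator *)

Lemma theta_annihilator q : theta q = annihilator (theta_module lambda q) :> set R.
Proof.
apply/seteqP; split=> r.
  move=> qr u; have [x ->] := module_projP u; rewrite module_projZ.
  by apply/module_proj_eq0; exact: (@idealMl _ (extend q)).
pose one : right_restriction eta := 1 : TT.
move=> /(_ (module_proj (ideal_submodule eta (extend q)) one)).
rewrite module_projZ => /module_proj_eq0 qr.
by change (ideal_set (extend q) (eta r)); rewrite -[eta r]mul1r; exact: qr.
Qed.

Lemma theta_base_change (q : Spec ZZ) (W : rmodType R) tau :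
  is_base_change eta q W tau -> theta q = annihilator W :> set R.
Proof.
move=> [[[tD1 tD2 tZ] univ uniq] act]; apply/seteqP; split=> r.
  move=> qr w.
  suff tau0 u x : ideal_set (extend q) x -> tau u x = 0.
    (* The action of [r] is additive, so by uniqueness in the universal property it vanishes once it
       kills every [tau u x]. *)
    apply: (uniq W (GRing.scale (r : R^c)) (GRing.null_fun W)) => u x.
    transitivity (tau u ((x : TT) * eta r)); first exact/esym/act.
    by apply: tau0; exact: (@idealMl _ (extend q)).
  have t0 v : tau v 0 = 0.
    by apply: (addrI (tau v 0)); rewrite -tD1 !addr0.
  move=> [s sq ->]; rewrite big_seq.
  apply: (big_ind (fun y => tau u y = 0)) => [|y y' ty ty'|p /sq[[b qb <-] _]].
  - exact: t0.
  - exact: etrans (tD1 u y y') (etrans (congr2 _ ty ty') (addr0 0)).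
  (* Balancedness moves [b] across to the first argument, where it kills [Z / q]. *)
  have -> : center_val b * p.2 = b *: (p.2 : restrict_scalars (@center_val TT) TT^o) by [].
  rewrite -tZ; have [c ->] := module_projP u.
  have -> : b *: module_proj (ideal_left_submodule q) c = 0.
    by rewrite module_projZ; apply/module_proj_eq0; exact: Defs.idealMr.
  by apply: (addrI (tau 0 p.2)); rewrite -tD2 !addr0.
(* Conversely, multiplication maps the tensor product to [T / q T]; evaluating at the tensor of [1]
   and [eta r] puts [eta r] in [q T]. *)
move=> ar; pose pr (x : TT) := module_proj (ideal_submodule eta (extend q)) x.
pose h0 (u : quotient_module (ideal_left_submodule q))
  (x : restrict_scalars (@center_val TT) TT^o) :=
  pr (center_val (module_repr u) * (x : TT)).
have h0E c x : h0 (module_proj _ c) x = pr (center_val c * x).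
  apply/module_projE; set c' := module_repr _.
  change (ideal_set (extend q) (center_val c' * (x : TT) - center_val c * (x : TT))).
  rewrite -mulrBl; apply: Defs.idealMr.
  rewrite -(rmorphB (@center_val TT)); apply: mem_extend.
  by apply/(module_projE (ideal_left_submodule q)); rewrite module_reprK.
have bal : balanced h0.
  split=> [u x y|u v x|z u x].
  - by rewrite /h0 mulrDr /pr module_projD.
  - have [c ->] := module_projP u; have [d ->] := module_projP v.
    by rewrite -module_projD !h0E center_valD mulrDl /pr module_projD.
  - have [c ->] := module_projP u; rewrite module_projZ !h0E center_valM.
    by rewrite centralC -mulrA.
have [h hE] := univ _ h0 bal.
pose u1 := module_proj (ideal_left_submodule q) (1 : center TT).
have := hE u1 (1 * eta r); rewrite act ar raddf0 h0E => /esym /module_proj_eq0.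
by rewrite !mul1r.
Qed.

(** * Maximal ideals of [Z] and primitive ideals of [R] *)

Lemma component_maximal l q : lies_over l q -> maximal_ideal q ->
  maximal_ideal (component l q).
Proof.
move=> lq [nq maxq]; split=> [eT|A sA]; first by case: (component_prime lq).
(* An ideal of [T l] above the component pulls back to [T] and contracts to an ideal of [Z] above
   [q]. *)
have sub : q `<=` contract (preim_ideal (@product_proj _ T l) A).
  by move=> z /mem_extend /(@mem_product_component _ _ l); exact: sA.
have [eq|eT] := maxq _ sub; [left|right].
  apply/seteqP; split=> // u Au.
  have eA : preim_ideal (@product_proj _ T l) A = extend q.
    by rewrite -(TcK (preim_ideal _ A)) (ideal_eq eq).
  change (ideal_set (extend q) (product_inj u)).
  by rewrite -eA /= /product_proj product_injE.
have : ideal_set (contract (preim_ideal (@product_proj _ T l) A)) 1 by rewrite eT.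
by move=> A1; exact: ideal_setT.
Qed.

Section Nullstellensatz.
Variables (k : fieldType) (alg : {rmorphism k -> center R}).
Hypothesis null : nullstellensatz alg.

Lemma theta_primitive_maximal q : right_primitive (theta q) -> maximal_ideal q.
Proof.
move=> [M simM annM]; split=> [|A sqA]; first by have [] := point_idealP q.
have [sAq|/not_subset_exists[z Az nqz]] := pselect (A `<=` q).
  by left; apply/seteqP.
right; apply: ideal_setT; apply/mem_extendP.
have [l lq] := lies_over_exists q.
have annl : preim_ideal (component_map l) (component l q) = annihilator M :> set R.
  by rewrite -annM -(thetaE lq).
have cz x : center_val z l * x = x * center_val z l := centralC (center_proj l z) x.
(* The endomorphism of [M] induced by [z] is algebraic over [k]; its relation [p] transfers to [T]
   modulo [q T], and with [z] in [A] but not in [q] this forces [1] into [extend A]. *)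
have [p p0 pz] := null.1 M simM
  (central_act (fractions_component l) (component_prime lq) simM annl cz).
pose g (c : k) : TT := eta (center_val (alg c)).
have gM c d : g c * g d = g (c * d) by rewrite /g rmorphM center_valM rmorphM.
apply: (@central_poly_mem _ k g (extend A) (extend q) (center_val z) p) => //.
- exact: extend_Spec_prime.
- exact: subset_extend.
- exact: mem_extend.
- by move/mem_extendP.
- by move=> x; exact: centralC.
- by rewrite /g !rmorph0.
- move=> c c0 /(idealMl (g c^-1)); rewrite gM mulVf //.
  by rewrite /g !rmorph1.
- apply/hasP; exists (lead_coef p); last by rewrite lead_coef_eq0.
  by rewrite mem_nth // prednK // size_poly_gt0.
rewrite -(product_primeE (extend_Spec_prime q) lq).
change (ideal_set (component l q)
  (product_proj l (\sum_(i < size p) g p`_i * center_val z ^+ i))).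
have -> : product_proj l (\sum_(i < size p) g p`_i * center_val z ^+ i) =
    \sum_(i < size p) component_map l (center_val (alg p`_i)) * center_val z l ^+ i.
  by rewrite rmorph_sum; apply: eq_bigr => i _; rewrite rmorphM rmorphXn.
apply: (central_act_poly (a := fun i => center_val (alg p`_i))) pz => i x.
exact: centralC.
Qed.

Lemma theta_maximal_primitive (q : Spec ZZ) : maximal_ideal q -> right_primitive (theta q).
Proof.
move=> maxq; apply: contrapT => nprim; have [l lq] := lies_over_exists q.
have lcq : locally_closed q.
  (* No prime lies strictly above [q], so [1] is a witness. *)
  apply/locally_closedP; exists 1; first exact (prime_ideal_not1 (point_idealP q)).
  move=> Q [sqQ nQq]; have [_ /(_ _ sqQ)[eQ|->//]] := maxq.
  by case: nQq; rewrite eQ.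
have /theta_locally_closed/locally_closedP[x nx xQ] := lcq.
(* If [theta q] is not primitive, each primitive ideal above it is strictly larger and contains the
   witness [x], so [x] is in [N]. Being nil modulo [theta q], the ideal [N] has to lie in [theta q],
   a contradiction. *)
pose N := [set y | jacobson_radical (quotient_ring (theta q)) (ring_proj (theta q) y)].
have N0 : N 0 by move=> P _; rewrite rmorph0; exact: ideal0.
have ND a b : N a -> N b -> N (a + b).
  by move=> Na Nb P pP; rewrite rmorphD; apply: idealD; [exact: Na|exact: Nb].
have Nl r a : N a -> N (r * a).
  by move=> Na P pP; rewrite rmorphM; apply/idealMl/Na.
have Nr r a : N a -> N (a * r).
  by move=> Na P pP; rewrite rmorphM; apply/Defs.idealMr/Na.
apply: nx; suff sN : Ideal N0 ND Nl Nr `<=` theta q.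
  apply: sN => P primP.
  have primP' := preim_primitive (@ring_proj_surj _ (theta q)) primP.
  change (ideal_set (preim_ideal (ring_proj (theta q)) P) x).
  apply: (xQ (IdealPoint (primitive_prime primP'))).
  have sqP : theta q `<=` preim_ideal (ring_proj (theta q)) P.
    by move=> y /ring_proj_eq0 /= ->; exact: ideal0.
  split=> // sPq; apply: nprim.
  suff -> : (theta q : ideal R) = preim_ideal (ring_proj (theta q)) P by [].
  by apply: ideal_eq; apply/seteqP.
rewrite (thetaE lq).
apply: (maximal_fractions_not_nil (fractions_component l) (hA l)).
- exact: component_maximal.
- rewrite -(thetaE lq) => y /ring_proj_eq0 qy P _.
  by rewrite qy; exact: ideal0.
- move=> y /(null.2 (theta q)) [n].
  rewrite -rmorphXn => /ring_proj_eq0; rewrite (thetaE lq) => Py.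
  by exists n; rewrite -rmorphXn.
Qed.

End Nullstellensatz.

End Theta.

Theorem mainTheorem1 (R : pzRingType) (t : nat) (I J : 'I_t -> ideal R)
  (D : forall l : 'I_t, set (quotient_ring (I l)))
  (T : 'I_t -> pzRingType)
  (lambda : forall l : 'I_t, {rmorphism quotient_ring (I l) -> T l})
  (specR : [set: Spec R] = \bigcup_(l in [set: 'I_t]) stratum I J l)
  (denominators : forall l, right_denominator_set (D l))
  (localizations : forall l, right_ore_localization (D l) (lambda l))
  (hA : forall l, right_noetherian (T l))
  (hB : forall l, factor_stratum I J l =
          [set Q : Spec (quotient_ring (I l)) | D l `<=` regular_modulo Q])
  (hC : forall l, ideally_commutative (T l)) :
  exists theta : Spec (center (product_ring T)) -> Spec R,
    (forall q, theta q = annihilator (theta_module lambda q) :> set R) /\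
    (forall (q : Spec (center (product_ring T))) (W : rmodType R) tau,
       is_base_change (eta_morphism lambda) q W tau ->
       theta q = annihilator W :> set R) /\
    [/\ continuous theta,
        forall P, finite_set [set q | theta q = P],
        forall P, exists q, theta q = P
      & trivIset [set: 'I_t] (stratum I J) -> bijective theta] /\
    (forall q, locally_closed (theta q) <-> locally_closed q) /\
    (forall (k : fieldType) (alg : {rmorphism k -> center R}),
       nullstellensatz alg ->
       (forall q, right_primitive (theta q) <-> maximal_ideal q) /\
       exists theta' : Max (center (product_ring T)) -> Prim R,
         [/\ forall m, theta' m = theta (Max_Spec m) :> ideal R,
             continuous theta',
             forall P, finite_set [set m | theta' m = P]
           & forall P, exists m, theta' m = P]).
Proof.
pose th := theta denominators localizations hA hC.
exists th; split; first exact: theta_annihilator.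
split; first by move=> q W tau; exact: theta_base_change.
split; first by split; [exact: theta_continuous|exact: theta_finite
  |exact (theta_surj specR denominators localizations hA hB hC)
  |exact (theta_bij specR denominators localizations hA hB hC)].
split; first exact (theta_locally_closed denominators localizations hA hB hC).
move=> k alg null.
have primE q : right_primitive (th q) <-> maximal_ideal q.
  split; first exact (theta_primitive_maximal null (q := q)).
  exact (theta_maximal_primitive denominators localizations hA hB hC null (q := q)).
split=> //.
have prim_th (m : Max (center (product_ring T))) : right_primitive (th (Max_Spec m)).
  exact (iffRL (primE (Max_Spec m)) (point_idealP m)).
exists (fun m => IdealPoint (prim_th m)); split=> //.
- apply/continuousP => U; rewrite Prim_openE Max_openE => -[E ->].
  (* The closed set found for [theta] on the whole spectrum also serves for the restriction. *)
  exists (contract (generated_ideal (eta_morphism lambda @` E))).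
  rewrite preimage_setC; congr setC; apply/seteqP; split=> m.
    exact (iffLR (theta_VP denominators localizations hA hC E (Max_Spec m))).
  exact (iffRL (theta_VP denominators localizations hA hC E (Max_Spec m))).
- move=> P; pose Q : Spec R := IdealPoint (primitive_prime (point_idealP P)).
  have inj : injective (@Max_Spec (center (product_ring T))).
    by move=> m m' e; apply: ideal_point_eq;
      exact (congr1 (fun q : Spec _ => ideal_set q) e).
  (* Each fiber embeds, by the injection of [Max] into [Spec], in a finite fiber of [theta]. *)
  have fin : finite_set (@Max_Spec _ @^-1` [set q | th q = Q]).
    by apply: finite_preimage => [m m' _ _|]; [exact: inj|exact: theta_finite].
  apply: sub_finite_set fin => m e; apply: ideal_point_eq.
  exact (congr1 (fun p : Prim _ => ideal_set p) e).
- move=> P; pose Q : Spec R := IdealPoint (primitive_prime (point_idealP P)).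
  have [q eq] : exists q, th q = Q
    := theta_surj specR denominators localizations hA hB hC Q.
  have maxq : maximal_ideal q
    by apply: (iffLR (primE q)); rewrite eq; exact (point_idealP P).
  exists (IdealPoint maxq); apply: ideal_point_eq.
  have <- : th q = Q :> set R by rewrite eq.
  by congr (th _ : set R); exact: ideal_point_eq.
Qed.
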